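(* Let $(G,* )$ be a metrizable topological group and $n\ge 0$ an integer. Then: (1) If $\dim(G)\le n$, then TWO has a winning strategy in ${\sf G}_c^{n+1}(\mathcal{O}_{\sf nbd},\mathcal{O})$. (2) If TWO has a winning strategy in ${\sf G}_c^{n+1}(\mathcal{O}_{\sf nbd},\mathcal{O})$, then $\dim(G)\le n$. (3) If $G$ is countable dimensional, then TWO has a winning strategy in ${\sf G}_c^{\omega}(\mathcal{O}_{\sf nbd},\mathcal{O})$. (4) If TWO has a winning strategy in ${\sf G}_c^{\omega}(\mathcal{O}_{\sf nbd},\mathcal{O})$, then $G$ is countable dimensional.
   Context: For a topological group $(G,* )$ with identity $e$ and a neighborhood $U$ of $e$, $\mathcal{O}(U)=\{x*U:x\in G\}$ and $\mathcal{O}_{\sf nbd}=\{\mathcal{O}(U):U\text{ a neighborhood of }e\}$. $\mathcal{O}$ is the collection of all open covers of $G$. A family $\mathcal{B}$ refines $\mathcal{A}$ if every member of $\mathcal{B}$ is contained in some member of $\mathcal{A}$. For an ordinal $\alpha$, the game ${\sf G}_c^{\alpha}(\mathcal{A},\mathcal{B})$ is played by ONE and TWO: in the $\beta$-th inning ($\beta<\alpha$) ONE chooses $\mathcal{O}_\beta\in\mathcal{A}$, and TWO responds with a pairwise disjoint family $\mathcal{T}_\beta$ of open sets refining $\mathcal{O}_\beta$. TWO wins the play if $\bigcup_{\beta<\alpha}\mathcal{T}_\beta\in\mathcal{B}$ (here: is a cover of $G$); otherwise ONE wins. A strategy for TWO is a function assigning to each finite (or, for length $\alpha$, each partial) sequence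 of ONE's moves TWO's response; it is winning if TWO wins every play in which TWO follows it. $\dim$ denotes covering dimension; $G$ is countable dimensional if it is a countable union of zero-dimensional subspaces. *)

(* Defs.v *)
From Stdlib Require Import Reals List Arith.
Open Scope R_scope.

Section Defs.
Variable G : Type.

Definition gset := G -> Prop.
Definition gfamily := gset -> Prop.

Definition is_metric (d : G -> G -> R) : Prop :=
  (forall x y, 0 <= d x y) /\
  (forall x y, d x y = 0 <-> x = y) /\
  (forall x y, d x y = d y x) /\
  (forall x y z, d x z <= d x y + d y z).

Definition metric_induces (opens : gfamily) (d : G -> G -> R) : Prop :=
  forall U : gset,
    opens U <-> (forall x, U x -> exists eps, 0 < eps /\
                          forall y, d x y < eps -> U y).

Definition is_group (mul : G -> G -> G) (inv : G -> G) (e : G) : Prop :=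
  (forall x y z, mul (mul x y) z = mul x (mul y z)) /\
  (forall x, mul e x = x /\ mul x e = x) /\
  (forall x, mul (inv x) x = e /\ mul x (inv x) = e).

Definition mul_continuous (opens : gfamily) (mul : G -> G -> G) : Prop :=
  forall x y (W : gset), opens W -> W (mul x y) ->
    exists U V : gset, opens U /\ opens V /\ U x /\ V y /\
      (forall u v, U u -> V v -> W (mul u v)).

Definition inv_continuous (opens : gfamily) (inv : G -> G) : Prop :=
  forall x (W : gset), opens W -> W (inv x) ->
    exists U : gset, opens U /\ U x /\ (forall u, U u -> W (inv u)).

Definition metrizable_topological_group (opens : gfamily)
    (mul : G -> G -> G) (inv : G -> G) (e : G) : Prop :=
  is_group mul inv e /\
  mul_continuous opens mul /\ inv_continuous opens inv /\
  exists d, is_metric d /\ metric_induces opens d.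

Definition empty_set : gset := fun _ => False.

(* A subspace A of G has covering dimension <= n : every finite open cover of
   A (open sets of A being traces of open sets of G) has a finite open
   refinement covering A whose order is <= n, i.e. every point of A lies in
   at most n+1 members (counted by index). *)
Definition dim_le (opens : gfamily) (A : gset) (n : nat) : Prop :=
  forall C : list gset,
    (forall U, In U C -> opens U) ->
    (forall x, A x -> exists U, In U C /\ U x) ->
    exists R : list gset,
      (forall V, In V R -> opens V) /\
      (forall x, A x -> exists V, In V R /\ V x) /\
      (forall V, In V R -> exists U, In U C /\ forall x, A x -> V x -> U x) /\
      (forall x (idx : list nat), A x -> NoDup idx ->
         (forall i, In i idx -> (i < length R)%nat /\ nth i R empty_set x) ->
         (length idx <= S n)%nat).

Definition countable_dimensional (opens : gfamily) : Prop :=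
  exists Z : nat -> gset,
    (forall x, exists k, Z k x) /\ (forall k, dim_le opens (Z k) 0).

Definition nbd_of_e (opens : gfamily) (e : G) (U : gset) : Prop :=
  exists W, opens W /\ W e /\ (forall x, W x -> U x).

Definition translates (mul : G -> G -> G) (U : gset) : gfamily :=
  fun A => exists x, A = (fun y => exists u, U u /\ y = mul x u).

Definition in_O_nbd (opens : gfamily) (mul : G -> G -> G) (e : G)
    (O : gfamily) : Prop :=
  exists U, nbd_of_e opens e U /\ O = translates mul U.

Definition legal_response (opens : gfamily) (O T : gfamily) : Prop :=
  (forall A, T A -> opens A) /\
  (forall A B, T A -> T B -> A <> B -> forall x, ~ (A x /\ B x)) /\
  (forall A, T A -> exists B, O B /\ forall x, A x -> B x).

(* strategies of TWO: maps from finite sequences of ONE's moves (in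
   chronological order) to TWO's responses *)
Definition strategy := list gfamily -> gfamily.

Definition response (s : strategy) (P : nat -> gfamily) (k : nat) : gfamily :=
  s (map P (seq 0 (S k))).

Definition winning_finite (opens : gfamily) (mul : G -> G -> G) (e : G)
    (m : nat) (s : strategy) : Prop :=
  forall P : nat -> gfamily,
    (forall k, (k < m)%nat -> in_O_nbd opens mul e (P k)) ->
    (forall k, (k < m)%nat -> legal_response opens (P k) (response s P k)) /\
    (forall x : G, exists k A, (k < m)%nat /\ response s P k A /\ A x).

Definition winning_omega (opens : gfamily) (mul : G -> G -> G) (e : G)
    (s : strategy) : Prop :=
  forall P : nat -> gfamily,
    (forall k, in_O_nbd opens mul e (P k)) ->
    (forall k, legal_response opens (P k) (response s P k)) /\
    (forall x : G, exists k A, response s P k A /\ A x).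

End Defs.

(* Main.v *)
Require Import Defs.
From Stdlib Require Import Reals List Arith Lra Lia Classical ClassicalEpsilon.
From Stdlib Require Cantor.
From mathcomp Require boolp wochoice.

(* A set is zero-dimensional when two-element open covers of it split into
   disjoint ones.  For a metrizable group, dim <= n means being the union of
   n+1 zero-dimensional sets, and TWO wins by covering the k-th summand in
   inning k: a zero-dimensional set can be covered by a disjoint open family
   refining any given open cover, because open covers of metric spaces have
   sigma-disjoint refinements.

   To decompose a space with dim <= n, take a sigma-disjoint base and separate
   its countably many levels by partitions any n+1 of which have empty
   intersection; the points lying on exactly j partitions form a
   zero-dimensional set.

   Conversely, given a winning strategy, let ONE play translates of balls of
   radius 1/(k+1).  The points caught whatever k is form a zero-dimensional
   set.  In the finite game the others lie in the countably many closed sets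
   missed by some first answer, where TWO wins a shorter game, and the countable
   sum theorem is only needed in dimension zero; in the infinite game every
   point is caught at one of the countably many finite histories. *)

(** * Choice, Archimedean bounds, well-ordering and coding of lists *)

Lemma dependent_choice_at (T : Type) (R : nat -> T -> T -> Prop) (s0 : T) :
  (forall n s, exists s', R n s s') ->
  exists f : nat -> T, f 0%nat = s0 /\ forall n, R n (f n) (f (S n)).
Proof.
  intros H.
  set (g := fun n s => proj1_sig (constructive_indefinite_description _ (H n s))).
  exists (fix f n := match n with O => s0 | S m => g m (f m) end).
  split; [reflexivity|]. intros n.
  exact (proj2_sig (constructive_indefinite_description _ (H n _))).
Qed.

Lemma least_nat (P : nat -> Prop) :
  (exists n, P n) -> exists n, P n /\ forall m, (m < n)%nat -> ~ P m.
Proof.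
  intros H. apply NNPP. intros Hn.
  assert (K : forall n, forall m, (m < n)%nat -> ~ P m).
  { induction n as [|n IH]; intros m Hm Pm; [lia|].
    destruct (Nat.eq_dec m n) as [->|]; [|apply (IH m); [lia|exact Pm]].
    apply Hn. exists n. split; assumption. }
  destruct H as [n Pn]. exact (K (S n) n (Nat.lt_succ_diag_r n) Pn).
Qed.

Lemma archimedean_inv (eps : R) : 0 < eps -> exists n, / INR (S n) < eps.
Proof.
  intros H. destruct (archimed_cor1 eps H) as [N [H1 H2]].
  exists (pred N). replace (S (pred N)) with N by lia. exact H1.
Qed.

Lemma inv_INR_S_pos n : 0 < / INR (S n).
Proof. apply Rinv_0_lt_compat, lt_0_INR. lia. Qed.

Lemma inv_INR_S_le n m : (n <= m)%nat -> / INR (S m) <= / INR (S n).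
Proof.
  intros H. apply Rinv_le_contravar; [apply lt_0_INR; lia|apply le_INR; lia].
Qed.

(** Least elements and antisymmetry are all that the refinement of covers uses. Antisymmetry comes
    from the uniqueness of the least element of a pair. *)
Lemma well_ordering (T : Type) : exists R : T -> T -> Prop,
  (forall P : T -> Prop, ex P -> exists z, P z /\ forall x, P x -> R z x) /\
  (forall x y, R x y -> R y x -> x = y).
Proof.
  destruct (wochoice.well_ordering_principle
    (boolp.boolp_classicType__canonical__eqtype_Equality T)) as [R HR].
  exists (fun x y => R x y = true).
  assert (HP : forall P : T -> Prop, ex P -> exists! z, P z /\ forall x, P x -> R z x = true).
  { intros P [w Pw].
    pose (p := fun x => if excluded_middle_informative (P x) then true else false).
    assert (Ep : forall x, p x = true <-> P x).
    { intros x. unfold p. destruct (excluded_middle_informative (P x)); split; auto; discriminate. }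
    destruct (HR p) as [z [[Hz Lz] Uz]].
    - exists w. apply Ep, Pw.
    - exists z. split; [split; [apply Ep, Hz|intros x Px; apply Lz, Ep, Px]|].
      intros z' [Pz' Lz']. apply Uz. split; [apply Ep, Pz'|].
      intros x Px. apply Lz', Ep, Px. }
  split.
  - intros P HPe. destruct (HP P HPe) as [z [Hz _]]. exists z. exact Hz.
  - assert (Rr : forall x, R x x = true).
    { intros x. destruct (HP (fun y => y = x)) as [z [[-> Hz] _]]; eauto. }
    intros x y Hxy Hyx.
    destruct (HP (fun z => z = x \/ z = y)) as [z [_ Uz]]; [eauto|].
    rewrite <- (Uz x); [|split; [auto|intros w [->| ->]; auto]].
    apply Uz. split; [auto|intros w [->| ->]; auto].
Qed.

(** Iterated Cantor unpairing. With the length as an argument, every number codes a list, and the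
    lists of one length are enumerated by all of [nat]. *)
Fixpoint decode_list (len k : nat) : list nat :=
  match len with
  | O => nil
  | S len => fst (Cantor.of_nat k) :: decode_list len (snd (Cantor.of_nat k))
  end.

Lemma length_decode_list len k : length (decode_list len k) = len.
Proof. revert k. induction len; intros k; simpl; auto. Qed.

Lemma decode_list_surj (l : list nat) : exists k, decode_list (length l) k = l.
Proof.
  induction l as [|a l [k Hk]]; [exists 0%nat; reflexivity|].
  exists (Cantor.to_nat (a, k)). cbn [length decode_list].
  rewrite Cantor.cancel_of_to. cbn [fst snd].
  rewrite Hk. reflexivity.
Qed.

(** * Open sets of a metric space and distance gauges *)

Section Metric.
Variable G : Type.
Variable opens : gfamily G.
Variable d : G -> G -> R.
Hypothesis Hd : is_metric G d.
Hypothesis Hopens : metric_induces G opens d.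

Notation gset := (gset G).

Lemma dist_ge0 x y : 0 <= d x y.
Proof. apply Hd. Qed.

Lemma dist_refl x : d x x = 0.
Proof. apply Hd. reflexivity. Qed.

Lemma dist_sym x y : d x y = d y x.
Proof. apply Hd. Qed.

Lemma dist_triangle x y z : d x z <= d x y + d y z.
Proof. apply Hd. Qed.

Lemma open_ball_in (U : gset) x : opens U -> U x ->
  exists eps, 0 < eps /\ forall y, d x y < eps -> U y.
Proof. intros HU Hx. exact (proj1 (Hopens U) HU x Hx). Qed.

Lemma open_True : opens (fun _ => True).
Proof. apply Hopens. intros x _. exists 1. split; [lra|trivial]. Qed.

Lemma open_const (P : Prop) : opens (fun _ => P).
Proof. apply Hopens. intros x HP. exists 1. split; [lra|trivial]. Qed.

Lemma open_inter (U V : gset) : opens U -> opens V -> opens (fun x => U x /\ V x).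
Proof.
  intros HU HV. apply Hopens. intros x [Ux Vx].
  destruct (open_ball_in U x HU Ux) as [a [Ha Ka]].
  destruct (open_ball_in V x HV Vx) as [b [Hb Kb]].
  exists (Rmin a b). split; [apply Rmin_glb_lt; assumption|].
  intros y Hy. split; [apply Ka|apply Kb];
    [apply Rlt_le_trans with (1 := Hy), Rmin_l|apply Rlt_le_trans with (1 := Hy), Rmin_r].
Qed.

Lemma open_union (I : Type) (U : I -> gset) :
  (forall i, opens (U i)) -> opens (fun x => exists i, U i x).
Proof.
  intros HU. apply Hopens. intros x [i Ux].
  destruct (open_ball_in (U i) x (HU i) Ux) as [a [Ha Ka]].
  exists a. split; [exact Ha|]. intros y Hy. exists i. exact (Ka y Hy).
Qed.

Lemma open_union_of (T : gfamily G) (P : gset -> Prop) :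
  (forall A, T A -> opens A) -> opens (fun x => exists A, T A /\ P A /\ A x).
Proof.
  intros HT. apply Hopens. intros x [A [TA [PA Ax]]].
  destruct (open_ball_in A x (HT A TA) Ax) as [a [Ha Ka]].
  exists a. split; [exact Ha|]. intros y Hy. exists A. auto.
Qed.

Lemma open_cup (U V : gset) : opens U -> opens V -> opens (fun x => U x \/ V x).
Proof.
  intros HU HV. apply Hopens. intros x [Ux|Vx].
  - destruct (open_ball_in U x HU Ux) as [a [Ha Ka]]. exists a. auto.
  - destruct (open_ball_in V x HV Vx) as [a [Ha Ka]]. exists a. auto.
Qed.

Lemma open_inter_lt (U : nat -> gset) (k : nat) :
  (forall l, (l < k)%nat -> opens (U l)) ->
  opens (fun x => forall l, (l < k)%nat -> U l x).
Proof.
  induction k as [|k IH]; intros HU.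
  - apply Hopens. intros x _. exists 1. split; [lra|]. intros; lia.
  - apply Hopens. intros x Hx.
    destruct (open_ball_in _ x (IH (fun l Hl => HU l (Nat.lt_lt_succ_r _ _ Hl)))) as [a [Ha Ka]].
    { intros l Hl. apply Hx. lia. }
    destruct (open_ball_in (U k) x (HU k (Nat.lt_succ_diag_r k)) (Hx k (Nat.lt_succ_diag_r k)))
      as [b [Hb Kb]].
    exists (Rmin a b). split; [apply Rmin_glb_lt; assumption|].
    intros y Hy l Hl. destruct (Nat.eq_dec l k) as [->|].
    + apply Kb. apply Rlt_le_trans with (1 := Hy), Rmin_r.
    + apply Ka; [|lia]. apply Rlt_le_trans with (1 := Hy), Rmin_l.
Qed.

Lemma open_inter_impl (P : Prop) (U : gset) : opens U -> opens (fun x => P -> U x).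
Proof.
  intros HU. apply Hopens. intros x Hx. destruct (classic P) as [HP|HP].
  - destruct (open_ball_in U x HU (Hx HP)) as [a [Ha Ka]]. exists a. auto.
  - exists 1. split; [lra|]. intros; contradiction.
Qed.

Lemma open_ball c r : opens (fun y => d c y < r).
Proof.
  apply Hopens. intros x Hx. exists (r - d c x). split; [lra|].
  intros y Hy. pose proof (dist_triangle c x y). lra.
Qed.

(** One-sided, but symmetry of [d] gives the bound on the absolute value. *)
Definition lipschitz (f : G -> R) := forall x y, f x - f y <= d x y.

Lemma open_lt_lipschitz (f h : G -> R) (a b : R) :
  lipschitz f -> lipschitz h -> 0 <= a -> 0 <= b ->
  opens (fun x => a * f x < b * h x).
Proof.
  intros Hf Hh Ha Hb. apply Hopens. intros x Hx.
  (* [b * h - a * f] is Lipschitz with constant [a + b]; the added 1 keeps the divisor positive when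
     both vanish. *)
  exists ((b * h x - a * f x) / (a + b + 1)).
  assert (0 < a + b + 1) by lra.
  split; [apply Rdiv_lt_0_compat; lra|].
  intros y Hy. apply (Rmult_lt_compat_r (a + b + 1)) in Hy; [|lra].
  unfold Rdiv in Hy. rewrite Rmult_assoc, Rinv_l, Rmult_1_r in Hy by lra.
  pose proof (Hf y x) as F1. pose proof (Hh x y) as F2. rewrite dist_sym in F1.
  pose proof (dist_ge0 x y).
  apply (Rmult_le_compat_l a) in F1; [|lra].
  apply (Rmult_le_compat_l b) in F2; [|lra]. nra.
Qed.

(* The distance to the complement of [U], truncated at 1 (so that it also makes
   sense when [U] is everything). *)
Definition gauge_radius (U : gset) (x : G) (r : R) : Prop :=
  0 <= r <= 1 /\ forall y, d x y < r -> U y.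

Lemma gauge_ex (U : gset) (x : G) : { g : R | is_lub (gauge_radius U x) g }.
Proof.
  apply completeness.
  - exists 1. intros r [Hr _]. lra.
  - exists 0. split; [lra|]. intros y Hy. pose proof (dist_ge0 x y). lra.
Qed.

Definition gauge (U : gset) (x : G) : R := proj1_sig (gauge_ex U x).

Lemma gauge_lub U x : is_lub (gauge_radius U x) (gauge U x).
Proof. exact (proj2_sig (gauge_ex U x)). Qed.

Lemma gauge_ge0 U x : 0 <= gauge U x.
Proof.
  apply gauge_lub. split; [lra|]. intros y Hy. pose proof (dist_ge0 x y). lra.
Qed.

Lemma gauge_pos_in U x : 0 < gauge U x -> U x.
Proof.
  intros H. apply NNPP. intros HU.
  assert (gauge U x <= 0); [|lra]. apply gauge_lub. intros r [Hr Kr].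
  destruct (Rle_lt_dec r 0) as [|Hp]; [assumption|].
  exfalso. apply HU, Kr. rewrite dist_refl. exact Hp.
Qed.

Lemma gauge_notin U x : ~ U x -> gauge U x = 0.
Proof.
  intros H. destruct (Rle_lt_or_eq_dec 0 (gauge U x) (gauge_ge0 U x)) as [K|K].
  - exfalso. apply H, gauge_pos_in, K.
  - symmetry. exact K.
Qed.

Lemma gauge_pos U x : opens U -> U x -> 0 < gauge U x.
Proof.
  intros HU Ux. destruct (open_ball_in U x HU Ux) as [eps [He Ke]].
  assert (0 < Rmin eps 1) by (apply Rmin_glb_lt; lra).
  apply Rlt_le_trans with (Rmin eps 1); [assumption|].
  apply gauge_lub. split; [split; [lra|apply Rmin_r]|].
  intros y Hy. apply Ke. apply Rlt_le_trans with (1 := Hy), Rmin_l.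
Qed.

Lemma gauge_lipschitz U : lipschitz (gauge U).
Proof.
  intros x y. assert (gauge U x <= gauge U y + d x y); [|lra].
  apply gauge_lub. intros r [Hr Kr].
  destruct (Rle_lt_dec (r - d x y) 0) as [H|H].
  - pose proof (gauge_ge0 U y). lra.
  - assert (r - d x y <= gauge U y); [|lra].
    apply gauge_lub. pose proof (dist_ge0 x y). split; [lra|].
    intros z Hz. apply Kr. pose proof (dist_triangle x y z). lra.
Qed.

Lemma open_gauge_lt U r : opens (fun x => gauge U x < r).
Proof.
  apply Hopens. intros x Hx. exists (r - gauge U x). split; [lra|].
  intros y Hy. pose proof (gauge_lipschitz U y x). rewrite dist_sym in Hy. lra.
Qed.

(** * Zero-dimensional subspaces *)

(** The sets are open in [G], but disjointness and inclusions are asked on [A] only. This agrees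
    with [dim_le] at 0, by [zero_dim_dim_le] and [dim_le_zero_dim]. *)
Definition zero_dim (A : gset) : Prop :=
  forall U V : gset, opens U -> opens V -> (forall x, A x -> U x \/ V x) ->
  exists U' V' : gset, opens U' /\ opens V' /\
    (forall x, A x -> U' x \/ V' x) /\
    (forall x, A x -> U' x -> V' x -> False) /\
    (forall x, A x -> U' x -> U x) /\ (forall x, A x -> V' x -> V x).

(** Adding [H] to one member of a cover of [B] gives a cover of [A], and [H] contributes nothing on
    [B]. *)
Lemma zero_dim_closed_subset (A B H : gset) :
  zero_dim A -> opens H -> (forall x, B x <-> A x /\ ~ H x) -> zero_dim B.
Proof.
  intros HA HH HB U V HU HV Hc.
  destruct (HA (fun x => U x \/ H x) V) as [U' [V' [oU [oV [C [D [IU IV]]]]]]].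
  - apply open_cup; assumption.
  - exact HV.
  - intros x Ax. destruct (classic (H x)) as [|nH]; [tauto|].
    destruct (Hc x); [apply HB; tauto|tauto|tauto].
  - exists U', V'. repeat split; try assumption.
    + intros x Bx. apply C, HB, Bx.
    + intros x Bx. apply D, HB, Bx.
    + intros x Bx Ux. apply HB in Bx. destruct (IU x); tauto.
    + intros x Bx Vx. apply IV; [apply HB, Bx|exact Vx].
Qed.

(** Each [T k] cuts [A] into disjoint relatively open pieces, and around every point some level has
    a small piece. A point is sent to the side of [U] or [V] at the first level whose piece around
    it lies in one of them. *)
Lemma zero_dim_of_families (A : gset) (T : nat -> gfamily G) :
  (forall k E, T k E -> opens E) ->
  (forall k E E' x, T k E -> T k E' -> E x -> E' x -> E = E') ->
  (forall k x, A x -> exists E, T k E /\ E x) ->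
  (forall x W, A x -> opens W -> W x ->
     exists k, forall E, T k E -> E x -> forall y, A y -> E y -> W y) ->
  zero_dim A.
Proof.
  intros HO HD HC HS U V HU HV Hcov.
  (* The three classes exclude each other; a member inside both [U] and [V] counts as [inU]. *)
  set (inU := fun E : gset => forall y, A y -> E y -> U y).
  set (inV := fun E : gset => ~ inU E /\ forall y, A y -> E y -> V y).
  set (out := fun E : gset => ~ inU E /\ ~ inV E).
  set (D := fun (Q : gset -> Prop) k x => exists E, T k E /\ Q E /\ E x).
  assert (oD : forall Q k, opens (D Q k)) by (intros; apply open_union_of, HO).
  assert (oDD : forall Q, opens (fun x => exists k, D Q k x /\ forall l, (l < k)%nat -> D out l x)).
  { intros Q. apply open_union. intros k. apply open_inter; [apply oD|].
    apply open_inter_lt. intros; apply oD. }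
  (* Only one member of [T k] contains [x], so [x] cannot have two exclusive classes at one
     level. *)
  assert (excl : forall Q Q' k x, (forall E, Q E -> Q' E -> False) -> D Q k x -> D Q' k x -> False).
  { intros Q Q' k x H [E [TS [QS Sx]]] [E' [TS' [QS' Sx']]].
    rewrite (HD k E E' x) in QS by assumption. exact (H E' QS QS'). }
  exists (fun x => exists k, D inU k x /\ forall l, (l < k)%nat -> D out l x),
         (fun x => exists k, D inV k x /\ forall l, (l < k)%nat -> D out l x).
  split; [apply oDD|]. split; [apply oDD|]. split; [|split; [|split]].
  - intros x Ax.
    destruct (least_nat (fun k => D inU k x \/ D inV k x)) as [k [Hk Hl]].
    { destruct (Hcov x Ax) as [Ux|Vx].
      - destruct (HS x U Ax HU Ux) as [k Hk]. destruct (HC k x Ax) as [E [TS Sx]].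
        exists k. left. exists E. unfold inU. eauto.
      - destruct (HS x V Ax HV Vx) as [k Hk]. destruct (HC k x Ax) as [E [TS Sx]].
        exists k. destruct (classic (inU E)) as [i|i].
        + left. exists E. auto.
        + right. exists E. unfold inV. eauto 6. }
    assert (Ho : forall l, (l < k)%nat -> D out l x).
    { intros l Hlk. destruct (HC l x Ax) as [E [TS Sx]]. exists E. split; [exact TS|].
      split; [|exact Sx]. specialize (Hl l Hlk). split; intros q; apply Hl;
      [left|right]; exists E; auto. }
    destruct Hk as [Hk|Hk]; [left|right]; exists k; auto.
  - intros x Ax [k [Hk Kk]] [l [Hl Kl]].
    destruct (Nat.lt_trichotomy k l) as [H|[->|H]].
    + apply (excl inU out k x); [unfold out; tauto|exact Hk|exact (Kl k H)].
    + apply (excl inU inV l x); [unfold inV; tauto|exact Hk|exact Hl].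
    + apply (excl inV out l x); [unfold out; tauto|exact Hl|exact (Kk l H)].
  - intros x Ax [k [[E [TS [QS Sx]]] _]]. exact (QS x Ax Sx).
  - intros x Ax [k [[E [TS [QS Sx]]] _]]. exact (proj2 QS x Ax Sx).
Qed.

(* A pair of open sets covering [A] records two sets with disjoint closures,
   namely [A \ M] and [A \ N]; shrinking the pair thickens both. *)
Record covering_pair (A : gset) (MN : gset * gset) : Prop := {
  covering_pair_l : opens (fst MN);
  covering_pair_r : opens (snd MN);
  covering_pair_cover : forall x, A x -> fst MN x \/ snd MN x }.

(** [P] and [Q] are open sets between the old and the new complements in [A]; through them the union
    of a chain of complements becomes relatively open. *)
Definition shrinks (A : gset) (MN MN' : gset * gset) : Prop :=
  covering_pair A MN' /\
  exists P Q : gset, opens P /\ opens Q /\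
   (forall x, A x -> ~ fst MN x -> P x) /\ (forall x, A x -> P x -> ~ fst MN' x) /\
   (forall x, A x -> ~ snd MN x -> Q x) /\ (forall x, A x -> Q x -> ~ snd MN' x).

Lemma shrinks_ex (A : gset) MN : covering_pair A MN ->
  exists MN', shrinks A MN MN'.
Proof.
  destruct MN as [M N]. intros [oM oN C]. simpl in *.
  pose proof (gauge_lipschitz M) as lM. pose proof (gauge_lipschitz N) as lN.
  (* On [A] the two gauges never vanish together, so a comparison of them up to a factor 2 separates
     the complements. The factors [1 *] fit [open_lt_lipschitz]. *)
  exists (fun x => 1 * gauge N x < 2 * gauge M x, fun x => 1 * gauge M x < 2 * gauge N x).
  split.
  - split; simpl.
    + apply open_lt_lipschitz; auto; lra.
    + apply open_lt_lipschitz; auto; lra.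
    + intros x Ax. pose proof (gauge_ge0 M x). pose proof (gauge_ge0 N x).
      destruct (C x Ax) as [H1|H1].
      * pose proof (gauge_pos M x oM H1).
        destruct (Rlt_le_dec (1 * gauge N x) (2 * gauge M x)); [left; assumption|right; lra].
      * pose proof (gauge_pos N x oN H1).
        destruct (Rlt_le_dec (1 * gauge N x) (2 * gauge M x)); [left; assumption|right; lra].
  - exists (fun x => 2 * gauge M x < 1 * gauge N x), (fun x => 2 * gauge N x < 1 * gauge M x).
    simpl. split; [apply open_lt_lipschitz; auto; lra|].
    split; [apply open_lt_lipschitz; auto; lra|].
    repeat split; intros x Ax H.
    + rewrite (gauge_notin M x H).
      assert (0 < gauge N x); [|lra]. apply gauge_pos; [exact oN|]. destruct (C x Ax); tauto.
    + lra.
    + rewrite (gauge_notin N x H).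
      assert (0 < gauge M x); [|lra]. apply gauge_pos; [exact oM|]. destruct (C x Ax); tauto.
    + lra.
Qed.

Lemma shrinks_weaken_r (A : gset) MN MN' MN'' :
  shrinks A MN MN' -> covering_pair A MN'' ->
  (forall x, A x -> fst MN'' x -> fst MN' x) ->
  (forall x, A x -> snd MN'' x -> snd MN' x) -> shrinks A MN MN''.
Proof.
  intros [_ [P [Q [oP [oQ [a [b [c e]]]]]]]] H I J.
  split; [exact H|]. exists P, Q. repeat split; auto.
  - intros x Ax Px K. apply (b x Ax Px), I; assumption.
  - intros x Ax Px K. apply (e x Ax Px), J; assumption.
Qed.

(** The complements increase along the chain. A point in both unions would, at a common later stage,
    lie outside both members of a covering pair. *)
Lemma shrinks_limit (A : gset) (f : nat -> gset * gset) :
  covering_pair A (f 0%nat) -> (forall n, shrinks A (f n) (f (S n))) ->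
  exists P Q : gset, opens P /\ opens Q /\
    (forall x, A x -> (P x <-> exists n, ~ fst (f n) x)) /\
    (forall x, A x -> (Q x <-> exists n, ~ snd (f n) x)) /\
    (forall x, A x -> P x -> Q x -> False).
Proof.
  intros H0 HS.
  assert (Hc : forall n, covering_pair A (f n)) by (intros [|n]; [exact H0|apply HS]).
  destruct (choice _ (fun n => proj2 (HS n))) as [P HP].
  destruct (choice _ HP) as [Q HQ]. clear HP.
  assert (ML : forall x n m, A x -> (n <= m)%nat -> ~ fst (f n) x -> ~ fst (f m) x).
  { intros x n m Ax Hnm Hn. induction Hnm as [|m Hnm IH]; [exact Hn|].
    destruct (HQ m) as [_ [_ [a [b _]]]]. auto. }
  assert (MR : forall x n m, A x -> (n <= m)%nat -> ~ snd (f n) x -> ~ snd (f m) x).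
  { intros x n m Ax Hnm Hn. induction Hnm as [|m Hnm IH]; [exact Hn|].
    destruct (HQ m) as [_ [_ [_ [_ [a b]]]]]. auto. }
  assert (EP : forall x, A x -> ((exists n, P n x) <-> exists n, ~ fst (f n) x)).
  { intros x Ax. split; intros [n Hn].
    - exists (S n). destruct (HQ n) as [_ [_ [_ [b _]]]]. auto.
    - exists n. destruct (HQ n) as [_ [_ [a _]]]. auto. }
  assert (EQ : forall x, A x -> ((exists n, Q n x) <-> exists n, ~ snd (f n) x)).
  { intros x Ax. split; intros [n Hn].
    - exists (S n). destruct (HQ n) as [_ [_ [_ [_ [_ b]]]]]. auto.
    - exists n. destruct (HQ n) as [_ [_ [_ [_ [a _]]]]]. auto. }
  exists (fun x => exists n, P n x), (fun x => exists n, Q n x).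
  split; [apply open_union; intros; apply HQ|].
  split; [apply open_union; intros; apply HQ|].
  split; [exact EP|]. split; [exact EQ|].
  intros x Ax Px Qx. apply (EP x Ax) in Px. apply (EQ x Ax) in Qx.
  destruct Px as [n Hn], Qx as [m Hm].
  destruct (covering_pair_cover _ _ (Hc (n + m)%nat) x Ax) as [K|K]; revert K.
  - apply (ML x n); [exact Ax|lia|exact Hn].
  - apply (MR x m); [exact Ax|lia|exact Hm].
Qed.

(** The countable sum theorem in dimension zero. A chain of pairs starts from the given cover; stage
    [n] puts every point of [B n] into one of the two complements, so the limit complements cover
    [A]. *)
Lemma zero_dim_countable_closed_union (A : gset) (B H : nat -> gset) :
  (forall i, opens (H i)) -> (forall i x, B i x <-> A x /\ ~ H i x) ->
  (forall x, A x -> exists i, B i x) -> (forall i, zero_dim (B i)) -> zero_dim A.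
Proof.
  intros oH EB CB ZB U V oU oV CUV.
  (* Dependent choice needs a successor for every pair, so the covering property is a premise inside
     the relation. *)
  assert (Hstep : forall n MN, exists MN', covering_pair A MN ->
    shrinks A MN MN' /\ forall x, B n x -> ~ fst MN' x \/ ~ snd MN' x).
  { intros n MN. destruct (classic (covering_pair A MN)) as [HMN|]; [|exists MN; tauto].
    destruct (shrinks_ex A MN HMN) as [[M N] HS].
    pose proof (proj1 HS) as [oM oN C]. simpl in *.
    destruct (ZB n M N oM oN) as [M' [N' [oM' [oN' [C' [D' [IM IN]]]]]]].
    { intros x Bx. apply C, (EB n), Bx. }
    (* The pair is left alone on [H n] and replaced on [B n] by the disjoint pair [M'], [N']. *)
    exists (fun x => M x /\ (H n x \/ M' x), fun x => N x /\ (H n x \/ N' x)).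
    intros _. split.
    - apply shrinks_weaken_r with (1 := HS); simpl; [|tauto|tauto]. split; simpl.
      + apply open_inter; [exact oM|apply open_cup; auto].
      + apply open_inter; [exact oN|apply open_cup; auto].
      + intros x Ax. destruct (classic (H n x)) as [h|h].
        * destruct (C x Ax); tauto.
        * assert (Bx : B n x) by (apply EB; tauto).
          destruct (C' x Bx) as [m|m]; [left|right]; auto.
    - simpl. intros x Bx. pose proof (proj2 (proj1 (EB n x) Bx)) as nH.
      specialize (D' x Bx). tauto. }
  destruct (dependent_choice_at _ _ (U, V) Hstep) as [f [f0 fS]].
  assert (c0 : covering_pair A (f 0%nat)) by (rewrite f0; split; simpl; auto).
  assert (fc : forall n, covering_pair A (f n)).
  { induction n as [|n IH]; [exact c0|]. apply (fS n IH). }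
  destruct (shrinks_limit A f c0 (fun n => proj1 (fS n (fc n))))
    as [P [Q [oP [oQ [EP [EQ D]]]]]].
  (* The sides are swapped: [P] contains the part of [A] outside [U], so [Q], being disjoint from it
     on [A], lies in [U] there. *)
  exists Q, P. split; [exact oQ|]. split; [exact oP|]. split; [|split; [|split]].
  - intros x Ax. destruct (CB x Ax) as [n Bx].
    destruct (proj2 (fS n (fc n)) x Bx) as [K|K].
    + right. apply EP; [exact Ax|]. exists (S n). exact K.
    + left. apply EQ; [exact Ax|]. exists (S n). exact K.
  - intros x Ax Qx Px. exact (D x Ax Px Qx).
  - intros x Ax Qx. apply NNPP. intros nU. apply (D x Ax); [|exact Qx].
    apply EP; [exact Ax|]. exists 0%nat. rewrite f0. exact nU.
  - intros x Ax Px. apply NNPP. intros nV. apply (D x Ax Px).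
    apply EQ; [exact Ax|]. exists 0%nat. rewrite f0. exact nV.
Qed.

(* Disjoint relatively open subsets of [A] are turned into disjoint open sets:
   when two of the balls below meet, the bigger of the doubled balls contains
   both centres. *)
Definition extend (A U : gset) : gset := fun y =>
  exists x r, A x /\ d x y < r /\ forall z, A z -> d x z < 2 * r -> U z.

Lemma open_extend A U : opens (extend A U).
Proof.
  apply Hopens. intros y [x [r [Ax [Hy Hr]]]].
  exists (r - d x y). split; [lra|]. intros z Hz. exists x, r.
  repeat split; auto. pose proof (dist_triangle x y z). lra.
Qed.

Lemma extend_disjoint A U V :
  (forall x, A x -> U x -> V x -> False) -> forall y, extend A U y -> extend A V y -> False.
Proof.
  intros D y [x [r [Ax [Hy Hr]]]] [x' [r' [Ax' [Hy' Hr']]]].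
  pose proof (dist_triangle x y x'). rewrite (dist_sym y x') in H.
  pose proof (dist_ge0 x y). pose proof (dist_ge0 x' y).
  destruct (Rle_lt_dec r r').
  - apply (D x Ax).
    + apply Hr; [exact Ax|]. rewrite dist_refl. lra.
    + apply Hr'; [exact Ax|]. rewrite dist_sym. lra.
  - apply (D x' Ax').
    + apply Hr; [exact Ax'|lra].
    + apply Hr'; [exact Ax'|]. rewrite dist_refl. lra.
Qed.

Lemma extend_in (A U : gset) x : opens U -> A x -> U x -> extend A U x.
Proof.
  intros oU Ax Ux. destruct (open_ball_in U x oU Ux) as [e [He Ke]].
  exists x, (e / 2). rewrite dist_refl. repeat split; [exact Ax|lra|].
  intros z _ Hz. apply Ke. lra.
Qed.

(** Split the cover into its head and the union of its tail, then refine the tail on the closed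
    remainder outside [U']. *)
Lemma zero_dim_list_refinement (C : list gset) : forall A : gset,
  zero_dim A -> (forall U, In U C -> opens U) ->
  (forall x, A x -> exists U, In U C /\ U x) ->
  exists R : nat -> gset, (forall i, opens (R i)) /\
    (forall i x, A x -> R i x -> nth i C (empty_set G) x) /\
    (forall i j x, A x -> R i x -> R j x -> i = j) /\
    (forall x, A x -> exists i, R i x).
Proof.
  induction C as [|U C IH]; intros A ZA oC cC.
  - exists (fun _ => empty_set G). split; [|split; [|split]].
    + intros _. exact (open_const False).
    + intros i x Ax. destruct (cC x Ax) as [U [[] _]].
    + intros i j x Ax. destruct (cC x Ax) as [U [[] _]].
    + intros x Ax. destruct (cC x Ax) as [U [[] _]].
  - destruct (ZA U (fun x => exists V, In V C /\ True /\ V x))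
      as [U' [V' [oU [oV [c [D [IU IV]]]]]]].
    + apply oC. left. reflexivity.
    + apply (open_union_of (fun V => In V C) (fun _ => True)). intros V HV. apply oC. right. exact HV.
    + intros x Ax. destruct (cC x Ax) as [V [[<-|HV] Vx]]; [left; exact Vx|right; eauto].
    + destruct (IH (fun x => A x /\ ~ U' x)) as [R [oR [iR [dR cR]]]].
      * apply zero_dim_closed_subset with (A := A) (H := U'); tauto.
      * intros V HV. apply oC. right. exact HV.
      * intros x [Ax nU]. destruct (IV x Ax) as [V [HV [_ Vx]]]; [|eauto].
        destruct (c x Ax); tauto.
      * assert (key : forall x, A x -> V' x -> A x /\ ~ U' x) by (intros x Ax Vx; split; [exact Ax|intros K; exact (D x Ax K Vx)]).
        exists (fun i => match i with O => U' | S i => fun x => V' x /\ R i x end).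
        split; [|split; [|split]].
        -- intros [|i]; [exact oU|apply open_inter; auto].
        -- intros [|i] x Ax; simpl; [auto|]. intros [Vx Rx]. apply iR; auto.
        -- intros [|i] [|j] x Ax; simpl; intros Hi Hj; [reflexivity| | |].
           ++ destruct (D x Ax); tauto.
           ++ destruct (D x Ax); tauto.
           ++ f_equal. apply (dR i j x); [apply key; tauto|tauto|tauto].
        -- intros x Ax. destruct (classic (U' x)) as [h|h]; [exists 0%nat; exact h|].
           destruct (cR x (conj Ax h)) as [i Hi]. exists (S i).
           destruct (c x Ax); tauto.
Qed.

(** [extend] makes the members disjoint off [A] too, but may leave the cover; intersecting with
    [nth i C] restores the inclusion. *)
Lemma zero_dim_open_list_refinement (C : list gset) (A : gset) :
  zero_dim A -> (forall U, In U C -> opens U) ->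
  (forall x, A x -> exists U, In U C /\ U x) ->
  exists R : nat -> gset, (forall i, opens (R i)) /\
    (forall i x, R i x -> nth i C (empty_set G) x) /\
    (forall i j x, R i x -> R j x -> i = j) /\
    (forall x, A x -> exists i, R i x).
Proof.
  intros ZA oC cC.
  destruct (zero_dim_list_refinement C A ZA oC cC) as [R [oR [iR [dR cR]]]].
  exists (fun i x => extend A (R i) x /\ nth i C (empty_set G) x). split; [|split; [|split]].
  - intros i. apply open_inter; [apply open_extend|].
    destruct (nth_in_or_default i C (empty_set G)) as [h|h]; [exact (oC _ h)|].
    rewrite h. exact (open_const False).
  - tauto.
  - intros i j x [Hi _] [Hj _]. destruct (Nat.eq_dec i j) as [h|h]; [exact h|].
    exfalso. apply (extend_disjoint A (R i) (R j)) with (y := x); [|exact Hi|exact Hj].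
    intros y Ay Ri Rj. exact (h (dR i j y Ay Ri Rj)).
  - intros x Ax. destruct (cR x Ax) as [i Hi]. exists i.
    split; [apply extend_in; auto|auto].
Qed.

(** * Covering dimension and zero-dimensional summands *)

Lemma nth_map_seq (f : nat -> gset) (n p : nat) x :
  nth p (map f (seq 0 n)) (empty_set G) x <-> (p < n)%nat /\ f p x.
Proof.
  destruct (Nat.lt_ge_cases p n) as [h|h].
  - rewrite nth_indep with (d' := f 0%nat) by (rewrite length_map, length_seq; exact h).
    rewrite map_nth, seq_nth by exact h. simpl. tauto.
  - rewrite nth_overflow by (rewrite length_map, length_seq; exact h).
    unfold empty_set. split; [tauto|lia].
Qed.

(** Each of the [n+1] summands has a disjoint refinement of the cover, and a point meets at most one
    member of each. *)
Lemma dim_le_of_zero_dim_union (A : gset) (n : nat) (Z : nat -> gset) :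
  (forall i, (i <= n)%nat -> zero_dim (Z i)) ->
  (forall x, A x -> exists i, (i <= n)%nat /\ Z i x) ->
  (forall i x, Z i x -> A x) ->
  dim_le G opens A n.
Proof.
  intros HZ cZ sZ C oC cC. set (L := length C).
  assert (HR : forall j, exists R : nat -> gset, (j <= n)%nat -> (forall i, opens (R i)) /\
    (forall i x, R i x -> nth i C (empty_set G) x) /\
    (forall i k x, R i x -> R k x -> i = k) /\
    (forall x, Z j x -> exists i, R i x)).
  { intros j. destruct (le_dec j n) as [h|h]; [|exists (fun _ => empty_set G); tauto].
    destruct (zero_dim_open_list_refinement C (Z j)) as [R HR]; eauto. }
  destruct (choice _ HR) as [R KR]. clear HR.
  assert (small : forall i x, nth i C (empty_set G) x -> (i < L)%nat).
  { intros i x Hx. destruct (Nat.lt_ge_cases i L) as [h|h]; [exact h|].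
    rewrite nth_overflow in Hx by exact h. destruct Hx. }
  assert (rng : forall p, (p < S n * L)%nat -> (0 < L)%nat /\ (p / L <= n)%nat).
  { intros p Hp. assert (0 < L)%nat by (destruct L; lia). split; [assumption|].
    apply Nat.lt_succ_r. apply Nat.Div0.div_lt_upper_bound. lia. }
  (* Position [i + j * L] holds the [i]-th member of the refinement for [Z j]. *)
  exists (map (fun p => R (p / L)%nat (p mod L)%nat) (seq 0 (S n * L))).
  split; [|split; [|split]].
  - intros V HV. apply in_map_iff in HV. destruct HV as [p [<- Hp]].
    apply in_seq in Hp. apply KR. apply rng. lia.
  - intros x Ax. destruct (cZ x Ax) as [j [Hj Zx]].
    destruct (KR j Hj) as [_ [iR [_ cR]]]. destruct (cR x Zx) as [i Rx].
    pose proof (small _ _ (iR i x Rx)) as Hi.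
    exists (R j i). split; [|exact Rx]. apply in_map_iff. exists (i + j * L)%nat. split.
    + rewrite Nat.div_add, Nat.Div0.mod_add, Nat.div_small, Nat.mod_small by lia. reflexivity.
    + apply in_seq. nia.
  - intros V HV. apply in_map_iff in HV. destruct HV as [p [<- Hp]].
    apply in_seq in Hp. destruct (rng p) as [HL Hpn]; [lia|].
    exists (nth (p mod L) C (empty_set G)). split.
    + apply nth_In. apply Nat.mod_upper_bound. lia.
    + intros x _. apply (proj1 (proj2 (KR _ Hpn))).
  - intros x idx Ax ND Hidx.
    assert (Hp : forall p, In p idx -> (p < S n * L)%nat /\ R (p / L)%nat (p mod L)%nat x).
    { intros p Ip. apply (nth_map_seq (fun p => R (p / L)%nat (p mod L)%nat)).
      apply Hidx, Ip. }
    (* Members of the same block are disjoint, so positions containing [x] have distinct quotients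
       by [L], and there are only [n+1] quotients. *)
    assert (NM : NoDup (map (fun p => p / L)%nat idx)).
    { apply NoDup_map_NoDup_ForallPairs; [|exact ND]. intros p q Ip Iq E.
      destruct (Hp p Ip) as [bp Rp], (Hp q Iq) as [bq Rq].
      rewrite <- E in Rq. destruct (rng p bp) as [HL Hpn].
      pose proof (proj1 (proj2 (proj2 (KR _ Hpn))) _ _ x Rp Rq) as Em.
      rewrite (Nat.div_mod_eq p L), (Nat.div_mod_eq q L), E, Em. reflexivity. }
    rewrite <- (length_map (fun p => p / L)%nat idx), <- (length_seq (S n) 0).
    apply NoDup_incl_length; [exact NM|].
    intros j Hj. apply in_map_iff in Hj. destruct Hj as [p [<- Ip]].
    apply in_seq. destruct (rng p); [apply Hp, Ip|lia].
Qed.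

Lemma zero_dim_dim_le (A : gset) : zero_dim A -> dim_le G opens A 0.
Proof.
  intros HA. apply dim_le_of_zero_dim_union with (Z := fun _ => A); eauto.
Qed.

(** Order 0 makes members at different positions disjoint on [A]; they are grouped by whether they
    lie in [U]. *)
Lemma dim_le_zero_dim (A : gset) : dim_le G opens A 0 -> zero_dim A.
Proof.
  intros HA U V oU oV c.
  destruct (HA (U :: V :: nil)) as [R [oR [cR [iR dR]]]].
  { intros W [<-|[<-|[]]]; assumption. }
  { intros x Ax. simpl. destruct (c x Ax); eauto. }
  set (inU := fun W : gset => forall x, A x -> W x -> U x).
  exists (fun x => exists W, In W R /\ inU W /\ W x),
         (fun x => exists W, In W R /\ ~ inU W /\ W x).
  split; [apply (open_union_of (fun W => In W R) inU oR)|].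
  split; [apply (open_union_of (fun W => In W R) (fun W => ~ inU W) oR)|].
  split; [|split; [|split]].
  - intros x Ax. destruct (cR x Ax) as [W [IW Wx]].
    destruct (classic (inU W)); [left|right]; eauto.
  - intros x Ax [W [IW [pW Wx]]] [W' [IW' [pW' Wx']]].
    apply (In_nth _ _ (empty_set G)) in IW, IW'.
    destruct IW as [i [Hi Ei]], IW' as [j [Hj Ej]].
    assert (ND : NoDup (i :: j :: nil)).
    { repeat constructor; simpl; [|tauto]. intros [->|[]]. congruence. }
    assert (length (i :: j :: nil) <= 1)%nat; [|simpl in *; lia].
    apply (dR x); [exact Ax|exact ND|].
    intros k [<-|[<-|[]]]; [rewrite Ei|rewrite Ej]; auto.
  - intros x Ax [W [IW [pW Wx]]]. exact (pW x Ax Wx).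
  - intros x Ax [W [IW [pW Wx]]]. destruct (iR W IW) as [W' [[<-|[<-|[]]] I]]; [|auto].
    exfalso. exact (pW I).
Qed.

(** * Disjoint refinements of infinite covers *)

(** [V m a] is made of balls whose centre has [a] as its least index and whose tripled ball lies in
    [u a]. If [V m a] and [V m b] meet, each tripled ball contains the other centre, so each index
    is at most the other. *)
Lemma sigma_disjoint_refinement (u : G -> gset) :
  (forall a, opens (u a)) -> (forall x, exists a, u a x) ->
  exists V : nat -> gfamily G,
    (forall m E, V m E -> opens E) /\
    (forall m E E' x, V m E -> V m E' -> E x -> E' x -> E = E') /\
    (forall m E, V m E -> exists a, forall x, E x -> u a x) /\
    (forall x, exists m E, V m E /\ E x).
Proof.
  intros ou cu. destruct (well_ordering G) as [R [wR aR]].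
  destruct (choice _ (fun c => wR (fun a => u a c) (cu c))) as [first Hfirst].
  set (r := fun m => / INR (S m)).
  assert (rpos : forall m, 0 < r m) by (intros; apply inv_INR_S_pos).
  set (V := fun m a y => exists c, first c = a /\ d c y < r m /\
              forall z, d c z < 3 * r m -> u a z).
  exists (fun m E => exists a, E = V m a). split; [|split; [|split]].
  - intros m E [a ->]. apply Hopens. intros y [c [Hc [Hy Hr]]].
    exists (r m - d c y). split; [lra|]. intros z Hz. exists c. repeat split; auto.
    pose proof (dist_triangle c y z). lra.
  - intros m E E' x [a ->] [b ->] [c [Hc [Hx Hr]]] [c' [Hc' [Hx' Hr']]].
    assert (a = b) as ->; [|reflexivity].
    pose proof (dist_triangle c x c'). rewrite (dist_sym x c') in H.
    pose proof (rpos m). subst a b. apply aR.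
    + apply Hfirst. apply Hr'. rewrite dist_sym. lra.
    + apply Hfirst. apply Hr. lra.
  - intros m E [a ->]. exists a. intros y [c [_ [Hy Hr]]]. apply Hr.
    pose proof (rpos m). lra.
  - intros x. destruct (open_ball_in (u (first x)) x (ou _) (proj1 (Hfirst x))) as [e [He Ke]].
    destruct (archimedean_inv (e / 3)) as [m Hm]; [lra|].
    exists m, (V m (first x)). split; [eauto|]. exists x. rewrite dist_refl.
    repeat split; [apply rpos|]. intros z Hz. apply Ke. unfold r in Hz. lra.
Qed.

(** On [A], the union of each level of a sigma-disjoint refinement is a countable union of
    relatively clopen sets. A point goes to the first of these containing it, then to its member of
    that level. *)
Lemma zero_dim_disjoint_refinement (A : gset) (u : G -> gset) :
  zero_dim A -> (forall a, opens (u a)) -> (forall x, exists a, u a x) ->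
  exists T : gfamily G,
    (forall E, T E -> opens E) /\
    (forall E E' x, T E -> T E' -> E x -> E' x -> E = E') /\
    (forall E, T E -> exists a, forall x, E x -> u a x) /\
    (forall x, A x -> exists E, T E /\ E x).
Proof.
  intros ZA ou cu.
  destruct (sigma_disjoint_refinement u ou cu) as [V [oV [dV [iV cV]]]].
  set (W := fun m x => exists E, V m E /\ True /\ E x).
  assert (oW : forall m, opens (W m)) by (intros; apply open_union_of, oV).
  set (lev := fun k => fst (Cantor.of_nat k)).
  set (rad := fun k => / INR (S (snd (Cantor.of_nat k)))).
  assert (HK : forall k, exists UV : gset * gset, opens (fst UV) /\ opens (snd UV) /\
    (forall x, A x -> fst UV x \/ snd UV x) /\
    (forall x, A x -> fst UV x -> snd UV x -> False) /\
    (forall x, A x -> fst UV x -> W (lev k) x) /\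
    (forall x, A x -> rad k <= gauge (W (lev k)) x -> fst UV x)).
  { intros k. destruct (ZA (W (lev k)) (fun x => gauge (W (lev k)) x < rad k))
      as [U' [V' [o1 [o2 [c [D [I1 I2]]]]]]].
    - apply oW.
    - apply open_gauge_lt.
    - intros x Ax. destruct (Rlt_le_dec (gauge (W (lev k)) x) (rad k)) as [h|h]; [right; exact h|].
      left. apply gauge_pos_in. pose proof (inv_INR_S_pos (snd (Cantor.of_nat k))).
      unfold rad in h. lra.
    - exists (U', V'). simpl. repeat split; auto.
      intros x Ax h. destruct (c x Ax) as [h'|h']; [exact h'|]. specialize (I2 x Ax h'). lra. }
  destruct (choice _ HK) as [K KK]. clear HK.
  (* On [A], [snd (K l)] is the complement of [fst (K l)], so [k] is the first index catching the
     point. *)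
  set (piece := fun k (E : gset) x => fst (K k) x /\ E x /\ forall l, (l < k)%nat -> snd (K l) x).
  set (T := fun k (E : gset) x => extend A (piece k E) x /\ E x).
  exists (fun S => exists k E, V (lev k) E /\ S = T k E). split; [|split; [|split]].
  - intros S [k [E [VE ->]]]. apply open_inter; [apply open_extend|exact (oV _ _ VE)].
  - intros S S' x [k [E [VE ->]]] [k' [E' [VE' ->]]] [Hx Ex] [Hx' Ex'].
    destruct (Nat.lt_trichotomy k k') as [h|[h|h]].
    + exfalso. apply (extend_disjoint A (piece k E) (piece k' E')) with (y := x); auto.
      intros y Ay [y1 _] [_ [_ y2]]. apply (KK k) with (x := y); auto.
    + subst k'. rewrite (dV _ E E' x VE VE' Ex Ex'). reflexivity.
    + exfalso. apply (extend_disjoint A (piece k E) (piece k' E')) with (y := x); auto.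
      intros y Ay [_ [_ y2]] [y1 _]. apply (KK k') with (x := y); auto.
  - intros S [k [E [VE ->]]]. destruct (iV _ E VE) as [a Ha]. exists a.
    intros x [_ Ex]. auto.
  - intros x Ax.
    destruct (least_nat (fun k => fst (K k) x)) as [k [Hk Hl]].
    { destruct (cV x) as [m [E [VE Ex]]].
      assert (Wx : W m x) by (exists E; auto).
      pose proof (gauge_pos (W m) x (oW m) Wx) as g.
      destruct (archimedean_inv _ g) as [p Hp].
      exists (Cantor.to_nat (m, p)).
      destruct (KK (Cantor.to_nat (m, p))) as [_ [_ [_ [_ [_ H]]]]].
      apply H; [exact Ax|]. unfold lev, rad. rewrite Cantor.cancel_of_to. simpl in *. lra. }
    destruct (KK k) as [o1 [_ [_ [_ [I _]]]]].
    destruct (I x Ax Hk) as [E [VE [_ Ex]]].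
    exists (T k E). split; [eauto|]. split; [|exact Ex].
    apply extend_in; [|exact Ax|].
    + apply open_inter; [exact o1|]. apply open_inter; [exact (oV _ _ VE)|].
      apply open_inter_lt. intros l _. apply KK.
    + split; [exact Hk|]. split; [exact Ex|]. intros l Hlk.
      destruct (KK l) as [_ [_ [c _]]]. destruct (c x Ax) as [h|h]; [|exact h].
      destruct (Hl l Hlk h).
Qed.

(** * Partitions with empty (n+1)-fold intersections *)

Notation whole := (fun _ : G => True).

(** A set inside one of these intersections lies on one side of each of the [k] pairs, so a
    refinement of this cover handles all pairs at once. *)
Fixpoint sign_cover (p : nat -> gset * gset) (k : nat) : list gset :=
  match k with
  | O => whole :: nil
  | S k => map (fun (U : gset) x => U x /\ fst (p k) x) (sign_cover p k) ++
           map (fun (U : gset) x => U x /\ snd (p k) x) (sign_cover p k)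
  end.

Lemma sign_coverP (p : nat -> gset * gset) (k : nat) :
  (forall j, (j < k)%nat -> covering_pair whole (p j)) ->
  (forall U, In U (sign_cover p k) -> opens U) /\
  (forall x, exists U, In U (sign_cover p k) /\ U x) /\
  (forall U j, In U (sign_cover p k) -> (j < k)%nat ->
     (forall x, U x -> fst (p j) x) \/ (forall x, U x -> snd (p j) x)).
Proof.
  induction k as [|k IH]; intros Hp; simpl.
  - split; [|split].
    + intros U [<-|[]]. apply open_True.
    + intros x. exists whole. auto.
    + intros; lia.
  - destruct IH as [oC [cC sC]]; [intros; apply Hp; lia|].
    destruct (Hp k) as [o1 o2 c]; [lia|].
    split; [|split].
    + intros U HU. apply in_app_or in HU. rewrite !in_map_iff in HU.
      destruct HU as [[W [<- HW]]|[W [<- HW]]]; apply open_inter; auto.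
    + intros x. destruct (cC x) as [U [HU Ux]]. destruct (c x I) as [h|h].
      * exists (fun x => U x /\ fst (p k) x). split; [|auto].
        apply in_or_app. left. apply in_map_iff. eauto.
      * exists (fun x => U x /\ snd (p k) x). split; [|auto].
        apply in_or_app. right. apply in_map_iff. eauto.
    + intros U j HU Hj. apply in_app_or in HU. rewrite !in_map_iff in HU.
      destruct (Nat.eq_dec j k) as [->|hj].
      * destruct HU as [[W [<- HW]]|[W [<- HW]]]; [left|right]; tauto.
      * destruct HU as [[W [<- HW]]|[W [<- HW]]];
          (destruct (sC W j HW) as [h|h]; [lia|left|right]); intros x [Wx _]; auto.
Qed.

Fixpoint max_gauge (C : list gset) (x : G) : R :=
  match C with
  | nil => 0
  | U :: C => Rmax (gauge U x) (max_gauge C x)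
  end.

Lemma max_gauge_lipschitz C : lipschitz (max_gauge C).
Proof.
  intros x y. induction C as [|U C IH]; simpl.
  - pose proof (dist_ge0 x y). lra.
  - pose proof (gauge_lipschitz U x y).
    unfold Rmax. repeat destruct Rle_dec; lra.
Qed.

Lemma gauge_le_max_gauge C U x : In U C -> gauge U x <= max_gauge C x.
Proof.
  induction C as [|W C IH]; simpl; [tauto|]. intros [->|h].
  - apply Rmax_l.
  - apply Rle_trans with (1 := IH h), Rmax_r.
Qed.

Lemma max_gauge_attained C x : 0 < max_gauge C x ->
  exists r, (r < length C)%nat /\ gauge (nth r C (empty_set G)) x = max_gauge C x.
Proof.
  induction C as [|W C IH]; simpl; [lra|]. intros h.
  destruct (Rle_dec (max_gauge C x) (gauge W x)) as [k|k].
  - exists 0%nat. split; [lia|]. rewrite Rmax_left by exact k. reflexivity.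
  - rewrite Rmax_right in h |- * by (apply Rlt_le, Rnot_le_lt, k).
    destruct (IH h) as [r [Hr Er]]. exists (S r). split; [lia|exact Er].
Qed.

(* The value of [gauge] relative to [max_gauge] is cut into the n+1 intervals
   [(j/(n+1), (j+1)/(n+1))], one for each pair.  A point lying between the two
   sides of every pair would have a member of the refinement in each interval,
   and moreover the one attaining the maximum: n+2 members in all. *)
Lemma dim_le_partition_step (n : nat) (p : nat -> gset * gset) :
  dim_le G opens whole n ->
  (forall j, (j <= n)%nat -> covering_pair whole (p j)) ->
  exists p' : nat -> gset * gset,
    (forall j, (j <= n)%nat -> covering_pair whole (p' j) /\
       (forall x, fst (p' j) x -> fst (p j) x) /\ (forall x, snd (p' j) x -> snd (p j) x)) /\
    (forall x, exists j, (j <= n)%nat /\ ~ (fst (p' j) x /\ snd (p' j) x)).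
Proof.
  intros Hdim Hp.
  destruct (sign_coverP p (S n)) as [oC [cC sC]]; [intros; apply Hp; lia|].
  destruct (Hdim (sign_cover p (S n)) oC (fun x _ => cC x)) as [R [oR [cR [iR dR]]]].
  set (m := max_gauge R). set (g := fun r => gauge (nth r R (empty_set G))).
  assert (Lm : lipschitz m) by apply max_gauge_lipschitz.
  assert (Lg : forall r, lipschitz (g r)) by (intros; apply gauge_lipschitz).
  assert (mpos : forall x, 0 < m x).
  { intros x. destruct (cR x I) as [V [IV Vx]].
    apply Rlt_le_trans with (gauge V x); [apply gauge_pos; auto|].
    apply gauge_le_max_gauge, IV. }
  assert (gin : forall r x, 0 < g r x -> nth r R (empty_set G) x).
  { intros r x. apply gauge_pos_in. }
  (* A member of the refinement leaving the first side of a pair lies in the second side. *)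
  set (meets := fun j r => ~ forall x, nth r R (empty_set G) x -> fst (p j) x).
  assert (meets_snd : forall j r x, (j <= n)%nat -> (r < length R)%nat -> meets j r ->
            nth r R (empty_set G) x -> snd (p j) x).
  { intros j r x Hj Hr Hm. destruct (iR _ (nth_In R (empty_set G) Hr)) as [U [HU IU]].
    destruct (sC U j HU) as [h|h]; [lia| |].
    - exfalso. apply Hm. intros y Hy. auto.
    - intros Hx. auto. }
  pose proof (lt_0_INR (S n) (Nat.lt_0_succ n)) as npos.
  exists (fun j => (fun x => forall r, (r < length R)%nat -> meets j r ->
                       INR (S n) * g r x < INR (S j) * m x,
                    fun x => exists r, ((r < length R)%nat /\ meets j r) /\
                       INR j * m x < INR (S n) * g r x)).
  split.
  - intros j Hj. pose proof (pos_INR j). pose proof (pos_INR (S j)).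
    assert (INR (S j) <= INR (S n)) by (apply le_INR; lia).
    assert (INR j < INR (S j)) by (apply lt_INR; lia).
    split; [split|split]; cbn [fst snd].
    + apply open_inter_lt. intros r Hr. apply open_inter_impl.
      apply open_lt_lipschitz; try apply pos_INR; auto.
    + apply open_union. intros r. apply open_inter; [apply open_const|].
      apply open_lt_lipschitz; try apply pos_INR; auto.
    + intros x _. apply NNPP. intros h. apply not_or_and in h. destruct h as [h1 h2].
      apply h1. intros r Hr Hm. apply Rnot_le_lt. intros h. apply h2. exists r.
      split; [auto|]. apply Rlt_le_trans with (2 := h).
      apply Rmult_lt_compat_r; [apply mpos|assumption].
    (* If [x] were off the first side, the member attaining the maximum would satisfy [meets]; its
       relative gauge 1 is not below [(j+1)/(n+1)]. *)
    + intros x Hx. apply NNPP. intros h.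
      destruct (max_gauge_attained R x (mpos x)) as [r [Hr Er]].
      assert (Hm : meets j r).
      { intros k. apply h, k, gin. unfold g. rewrite Er. apply mpos. }
      specialize (Hx r Hr Hm). unfold g in Hx. rewrite Er in Hx. fold (m x) in Hx.
      pose proof (mpos x). nra.
    + intros x [r [[Hr Hm] Hx]]. apply (meets_snd j r x Hj Hr Hm), gin.
      pose proof (mpos x).
      destruct (Rle_lt_dec (g r x) 0); [|assumption]. nra.
  - intros x. apply NNPP. intros Hno.
    assert (Hall : forall j, (j <= n)%nat -> exists r, (r < length R)%nat /\
              INR j * m x < INR (S n) * g r x < INR (S j) * m x).
    { intros j Hj. apply NNPP. intros h. apply Hno. exists j. split; [exact Hj|].
      simpl. intros [h1 [r [[Hr Hm] h2]]]. apply h. exists r. auto. }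
    pose proof (mpos x) as mx.
    assert (Hl : forall k, (k <= S n)%nat -> exists l, NoDup l /\ length l = k /\
       forall r, In r l -> (r < length R)%nat /\ nth r R (empty_set G) x /\
                           INR (S n) * g r x < INR k * m x).
    { induction k as [|k IH]; intros Hk.
      - exists nil. split; [constructor|]. split; [reflexivity|]. simpl; tauto.
      - destruct IH as [l [ND [Hlen Hl]]]; [lia|].
        destruct (Hall k) as [r [Hr [H1 H2]]]; [lia|].
        pose proof (pos_INR k).
        exists (r :: l). split; [|split].
        + constructor; [|exact ND]. intros Ir. destruct (Hl r Ir) as [_ [_ H3]]. lra.
        + simpl. rewrite Hlen. reflexivity.
        + intros q [<-|Iq].
          * split; [exact Hr|]. split; [|exact H2]. apply gin.
            destruct (Rle_lt_dec (g r x) 0); [|assumption]. nra.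
          * destruct (Hl q Iq) as [a [b c]]. split; [exact a|]. split; [exact b|].
            apply Rlt_le_trans with (1 := c). apply Rmult_le_compat_r; [lra|].
            apply le_INR. lia. }
    destruct (Hl (S n) (Nat.le_refl _)) as [l [ND [Hlen Hin]]].
    destruct (max_gauge_attained R x (mpos x)) as [r [Hr Er]].
    assert (length (r :: l) <= S n)%nat; [|simpl in *; lia].
    apply (dR x); [exact I| |].
    + constructor; [|exact ND]. intros Ir. destruct (Hin r Ir) as [_ [_ h]].
      unfold g in h. rewrite Er in h. fold (m x) in h. lra.
    + intros q [<-|Iq].
      * split; [exact Hr|]. apply gin. unfold g. rewrite Er. exact mx.
      * destruct (Hin q Iq) as [a [b _]]. auto.
Qed.

(** All pairs are shrunk first; those listed in [S] are then cut further, by the pairs attached to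
    their positions. [S] names the list here, hence [Datatypes.S]. *)
Lemma dim_le_partition_state_step (n : nat) (S : list nat) (p : nat -> gset * gset) :
  dim_le G opens whole n -> NoDup S -> length S = Datatypes.S n ->
  (forall i, covering_pair whole (p i)) ->
  exists p', (forall i, shrinks whole (p i) (p' i)) /\
    forall x, exists i, In i S /\ (~ fst (p' i) x \/ ~ snd (p' i) x).
Proof.
  intros Hdim ND Hlen Hp.
  destruct (choice _ (fun i => shrinks_ex whole (p i) (Hp i))) as [q Hq].
  destruct (dim_le_partition_step n (fun j => q (nth j S 0%nat)) Hdim) as [r [Hr Er]].
  { intros j _. apply Hq. }
  (* [NoDup S] makes the position [j] of [i] unique; for [i] outside [S] the extra conditions are
     vacuous. *)
  set (at_ := fun j i => (j < Datatypes.S n)%nat /\ nth j S 0%nat = i).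
  exists (fun i => (fun x => fst (q i) x /\ forall j, (j < Datatypes.S n)%nat -> at_ j i -> fst (r j) x,
                    fun x => snd (q i) x /\ forall j, (j < Datatypes.S n)%nat -> at_ j i -> snd (r j) x)).
  split.
  - intros i. apply shrinks_weaken_r with (1 := Hq i); simpl; [|tauto|tauto].
    destruct (Hq i) as [[o1 o2 c] _].
    assert (Hop : forall j, (j < Datatypes.S n)%nat -> covering_pair whole (r j)).
    { intros j Hj. apply Hr. lia. }
    split; simpl.
    + apply open_inter; [exact o1|]. apply open_inter_lt. intros j Hj.
      apply open_inter_impl. apply (Hop j Hj).
    + apply open_inter; [exact o2|]. apply open_inter_lt. intros j Hj.
      apply open_inter_impl. apply (Hop j Hj).
    + intros x _. destruct (classic (exists j, at_ j i)) as [[j [Hj Ej]]|h].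
      * assert (uniq : forall j', at_ j' i -> j' = j).
        { intros j' [Hj' Ej']. apply (proj1 (NoDup_nth S 0%nat) ND); congruence. }
        destruct (Hr j) as [cj [i1 i2]]; [lia|].
        destruct (covering_pair_cover _ _ cj x I) as [h|h]; [left|right].
        -- split; [rewrite <- Ej; auto|]. intros j' _ Hj'. rewrite (uniq j' Hj'). exact h.
        -- split; [rewrite <- Ej; auto|]. intros j' _ Hj'. rewrite (uniq j' Hj'). exact h.
      * destruct (c x I) as [h'|h']; [left|right]; (split; [exact h'|]);
          intros j _ Hj; destruct h; eauto.
  - intros x. destruct (Er x) as [j [Hj h]]. exists (nth j S 0%nat).
    split; [apply nth_In; lia|]. simpl.
    apply NNPP. intros k. apply h. apply not_or_and in k. destruct k as [k1 k2].
    apply NNPP in k1, k2. split.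
    + apply k1; [lia|split; [lia|reflexivity]].
    + apply k2; [lia|split; [lia|reflexivity]].
Qed.

(** Lists of [n+1] indices are countable. Stage [k] shrinks every pair and treats the [k]-th list;
    what stage [k] puts into a complement stays in the limit. *)
Lemma dim_le_partitions (n : nat) (p : nat -> gset * gset) :
  dim_le G opens whole n -> (forall i, covering_pair whole (p i)) ->
  exists P Q : nat -> gset,
    (forall i, opens (P i)) /\ (forall i, opens (Q i)) /\
    (forall i x, P i x -> Q i x -> False) /\
    (forall i x, ~ fst (p i) x -> P i x) /\ (forall i x, ~ snd (p i) x -> Q i x) /\
    (forall S x, NoDup S -> length S = Datatypes.S n -> exists i, In i S /\ (P i x \/ Q i x)).
Proof.
  intros Hdim Hp.
  assert (Hstep : forall k (q : nat -> gset * gset), exists q',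
    (forall i, covering_pair whole (q i)) ->
    (forall i, shrinks whole (q i) (q' i)) /\
    (NoDup (decode_list (S n) k) ->
      forall x, exists i, In i (decode_list (S n) k) /\ (~ fst (q' i) x \/ ~ snd (q' i) x))).
  { intros k q. destruct (classic (forall i, covering_pair whole (q i))) as [Hq|]; [|exists q; tauto].
    destruct (classic (NoDup (decode_list (S n) k))) as [h|h].
    - destruct (dim_le_partition_state_step n _ q Hdim h (length_decode_list _ _) Hq)
        as [q' [H1 H2]]. exists q'. auto.
    - destruct (choice _ (fun i => shrinks_ex whole (q i) (Hq i))) as [q' Hq'].
      exists q'. tauto. }
  destruct (dependent_choice_at _ _ p Hstep) as [f [f0 fS]].
  assert (fc : forall k i, covering_pair whole (f k i)).
  { induction k as [|k IH]; intros i; [rewrite f0; apply Hp|]. apply (fS k IH). }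
  assert (Hlim : forall i, exists PQ : gset * gset, opens (fst PQ) /\ opens (snd PQ) /\
    (forall x, fst PQ x <-> exists k, ~ fst (f k i) x) /\
    (forall x, snd PQ x <-> exists k, ~ snd (f k i) x) /\
    (forall x, fst PQ x -> snd PQ x -> False)).
  { intros i. destruct (shrinks_limit whole (fun k => f k i)) as [P [Q [a [b [c [e g]]]]]].
    - apply fc.
    - intros k. apply (fS k (fc k)).
    - exists (P, Q). simpl. split; [|split; [|split; [|split]]]; auto. intros x; apply g; exact I. }
  destruct (choice _ Hlim) as [PQ HPQ].
  exists (fun i => fst (PQ i)), (fun i => snd (PQ i)).
  split; [intros; apply HPQ|]. split; [intros; apply HPQ|].
  split; [intros i x; apply HPQ|].
  split; [intros i x h; apply HPQ; exists 0%nat; rewrite f0; exact h|].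
  split; [intros i x h; apply HPQ; exists 0%nat; rewrite f0; exact h|].
  intros S x ND Hlen. destruct (decode_list_surj S) as [k Hk]. rewrite Hlen in Hk.
  destruct (fS k (fc k)) as [_ H]. rewrite Hk in H.
  destruct (H ND x) as [i [Ii Hi]]. exists i. split; [exact Ii|].
  destruct Hi as [Hi|Hi]; [left|right]; apply HPQ; eauto.
Qed.

(** * Decomposition into zero-dimensional summands *)

(** Otherwise a duplicate-free list in [L] of length at most [n] could always be lengthened, up to
    the forbidden length [n+1]. *)
Lemma bounded_nat_set_enumeration (L : nat -> Prop) (n : nat) :
  (forall S, NoDup S -> length S = Datatypes.S n -> exists i, In i S /\ ~ L i) ->
  exists J, (length J <= n)%nat /\ NoDup J /\ forall i, In i J <-> L i.
Proof.
  intros H. apply NNPP. intros Hno.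
  assert (K : forall j, (j <= S n)%nat ->
    exists J, length J = j /\ NoDup J /\ forall i, In i J -> L i).
  { induction j as [|j IH]; intros Hj.
    - exists nil. split; [reflexivity|]. split; [constructor|]. simpl; tauto.
    - destruct IH as [J [Hlen [ND HJ]]]; [lia|].
      assert (exists i, L i /\ ~ In i J) as [i [Li nI]].
      { apply NNPP. intros h. apply Hno. exists J. split; [lia|]. split; [exact ND|].
        intros i. split; [apply HJ|]. intros Li. apply NNPP. intros nI. apply h. eauto. }
      exists (i :: J). split; [simpl; lia|]. split; [constructor; auto|].
      intros k [<-|Ik]; auto. }
  destruct (K (S n) (Nat.le_refl _)) as [J [Hlen [ND HJ]]].
  destruct (H J ND Hlen) as [i [Ii nL]]. exact (nL (HJ i Ii)).
Qed.

(* The [j]-th summand consists of the points lying on exactly [j] of the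
   partitions attached to a sigma-disjoint base. *)
Lemma dim_le_zero_dim_decomposition (n : nat) :
  dim_le G opens whole n ->
  exists Z : nat -> gset, (forall j, zero_dim (Z j)) /\
    forall x, exists j, (j <= n)%nat /\ Z j x.
Proof.
  intros Hdim.
  assert (HV : forall a, exists V : nat -> gfamily G,
    (forall m E, V m E -> opens E) /\
    (forall m E E' x, V m E -> V m E' -> E x -> E' x -> E = E') /\
    (forall m E, V m E -> exists c, forall x, E x -> d c x < / INR (S a)) /\
    (forall x, exists m E, V m E /\ E x)).
  { intros a. apply (sigma_disjoint_refinement (fun c x => d c x < / INR (S a))).
    - intros c. apply open_ball.
    - intros x. exists x. rewrite dist_refl. apply inv_INR_S_pos. }
  destruct (choice _ HV) as [V' HV']. clear HV.
  (* An index codes a mesh [1/(a+1)], a disjoint level of the cover of that mesh, and a radius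
     bounding the gauge of that level. *)
  set (lev := fun k => fst (Cantor.of_nat k)).
  set (sub := fun k => fst (Cantor.of_nat (snd (Cantor.of_nat k)))).
  set (rad := fun k => / INR (S (snd (Cantor.of_nat (snd (Cantor.of_nat k)))))).
  set (V := fun k => V' (lev k) (sub k)).
  set (W := fun k x => exists E, V k E /\ True /\ E x).
  assert (oV : forall k E, V k E -> opens E) by (intros k E; apply HV').
  assert (oW : forall k, opens (W k)) by (intros; apply open_union_of, oV).
  (* [P k] will contain the points deep inside [W k], and [Q k] those outside [W k]. *)
  destruct (dim_le_partitions n (fun k => (fun x => gauge (W k) x < rad k, W k)) Hdim)
    as [P [Q [oP [oQ [dPQ [iP [iQ HL]]]]]]].
  { intros k. split; simpl; [apply open_gauge_lt|apply oW|].
    intros x _. destruct (Rlt_le_dec (gauge (W k) x) (rad k)) as [h|h]; [left; exact h|].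
    right. apply gauge_pos_in. apply Rlt_le_trans with (2 := h), inv_INR_S_pos. }
  simpl in iP, iQ.
  set (L := fun x i => ~ (P i x \/ Q i x)).
  set (Z := fun j x => exists J, length J = j /\ NoDup J /\ forall i, In i J <-> L x i).
  exists Z. split.
  2: { intros x. destruct (bounded_nat_set_enumeration (L x) n) as [J [H1 [H2 H3]]].
       - intros S ND Hlen. destruct (HL S x ND Hlen) as [i [Ii Hi]]. exists i. unfold L. tauto.
       - exists (length J). split; [exact H1|]. exists J. auto. }
  intros j.
  set (J := decode_list j).
  (* Off [H k], a point of [Z j] lies on all [j] partitions listed in [J k], hence on exactly
     these. *)
  set (H := fun k x => ~ NoDup (J k) \/ exists i, In i (J k) /\ (P i x \/ Q i x)).
  apply zero_dim_countable_closed_union with (B := fun k x => Z j x /\ ~ H k x) (H := H).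
  - intros k. apply open_cup; [apply open_const|]. apply open_union. intros i.
    apply open_inter; [apply open_const|apply open_cup; auto].
  - tauto.
  - intros x [J' [Hlen [ND HJ]]]. destruct (decode_list_surj J') as [k Hk].
    rewrite Hlen in Hk. exists k. split; [exists J'; auto|].
    unfold H, J. rewrite Hk. intros [h|[i [Ii Hi]]]; [auto|]. apply HJ in Ii. exact (Ii Hi).
  - intros k.
    assert (Hex : forall x, Z j x -> ~ H k x -> forall i, In i (J k) <-> L x i).
    { intros x [J' [Hlen [ND HJ]]] nH.
      assert (NDk : NoDup (J k)) by (apply NNPP; intros h; apply nH; left; exact h).
      assert (I1 : incl (J k) J').
      { intros i Ii. apply HJ. intros h. apply nH. right. eauto. }
      assert (I2 : incl J' (J k)).
      { apply NoDup_length_incl; [exact NDk| |exact I1].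
        unfold J. rewrite length_decode_list. lia. }
      intros i. rewrite <- HJ. split; auto. }
    (* A partition in [J k] contains all the points concerned and cannot split them, so its family
       is trivial. The others split into [Q l] and the members of [V l] cut by [P l]. *)
    set (T := fun l (E : gset) => (In l (J k) /\ E = whole) \/
       (~ In l (J k) /\ ((exists F, V l F /\ E = fun x => P l x /\ F x) \/ E = Q l))).
    apply zero_dim_of_families with (T := T).
    + intros l E [[_ ->]|[_ [[F [VF ->]]| ->]]].
      * apply open_True.
      * apply open_inter; [apply oP|exact (oV l F VF)].
      * apply oQ.
    + intros l E E' x [[h ->]|[h [[F [VF ->]]| ->]]] [[h' ->]|[h' [[F' [VF' ->]]| ->]]];
        try tauto; intros Hx Hx'.
      * destruct (HV' (lev l)) as [_ [dV _]].
        rewrite (dV _ F F' x VF VF'); tauto.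
      * destruct (dPQ l x); tauto.
      * destruct (dPQ l x); tauto.
    + intros l x [Zx nH]. destruct (classic (In l (J k))) as [h|h].
      * exists whole. split; [left; auto|exact I].
      * rewrite (Hex x Zx nH) in h. apply NNPP in h. destruct h as [h|h].
        -- assert (W l x) as [F [VF [_ Fx]]].
           { apply NNPP. intros nW. exact (dPQ l x h (iQ l x nW)). }
           exists (fun x => P l x /\ F x). split; [|auto]. right.
           split; [rewrite (Hex x Zx nH); unfold L; tauto|]. left. exists F. auto.
        -- exists (Q l). split; [|exact h]. right. rewrite (Hex x Zx nH). unfold L. tauto.
    + intros x O [Zx nH] oO Ox.
      destruct (open_ball_in O x oO Ox) as [e [He Ke]].
      destruct (archimedean_inv (e / 2)) as [a0 Ha0]; [lra|].
      (* The mesh index exceeds the levels of all indices in [J k], so the index [l] built from it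
         is outside [J k]. *)
      set (a := (a0 + S (list_max (map lev (J k))))%nat).
      assert (Ha : / INR (S a) < e / 2).
      { apply Rle_lt_trans with (2 := Ha0). apply inv_INR_S_le. lia. }
      destruct (HV' a) as [_ [_ [mV cV]]]. destruct (cV x) as [m [F [VF Fx]]].
      assert (oF : opens (fun x => exists E, V' a m E /\ True /\ E x))
        by (apply open_union_of, HV').
      assert (g : 0 < gauge (fun x => exists E, V' a m E /\ True /\ E x) x)
        by (apply gauge_pos; [exact oF|eauto]).
      destruct (archimedean_inv _ g) as [q Hq].
      set (l := Cantor.to_nat (a, Cantor.to_nat (m, q))).
      assert (El : lev l = a) by (unfold lev, l; rewrite Cantor.cancel_of_to; reflexivity).
      assert (Em : sub l = m)
        by (unfold sub, l; rewrite Cantor.cancel_of_to; cbn [snd]; rewrite Cantor.cancel_of_to; reflexivity).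
      assert (Er : rad l = / INR (S q))
        by (unfold rad, l; rewrite Cantor.cancel_of_to; cbn [snd]; rewrite Cantor.cancel_of_to; reflexivity).
      assert (nl : ~ In l (J k)).
      { intros h. pose proof (proj1 (list_max_le (map lev (J k)) _) (Nat.le_refl _)) as hm.
        rewrite Forall_forall in hm. specialize (hm (lev l) (in_map lev _ _ h)).
        rewrite El in hm. unfold a in hm. lia. }
      assert (Px : P l x).
      { apply iP. rewrite Er. unfold W, V. rewrite El, Em. lra. }
      exists l. intros E [[h _]|[_ [[F' [VF' ->]]| ->]]].
      * contradiction.
      * intros [_ Fx'] y _ [_ Fy]. unfold V in VF'. rewrite El, Em in VF'.
        destruct (mV m F' VF') as [c Hc]. apply Ke.
        pose proof (Hc x Fx'). pose proof (Hc y Fy).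
        pose proof (dist_triangle x c y). rewrite (dist_sym x c) in H2. lra.
      * intros Qx. destruct (dPQ l x Px Qx).
Qed.

(** * The game on the translates of neighbourhoods of the identity *)

Variables (mul : G -> G -> G) (inv : G -> G) (e : G).
Hypothesis Hgroup : is_group G mul inv e.
Hypothesis Hmul : mul_continuous G opens mul.
Hypothesis Hinv : inv_continuous G opens inv.

Lemma mul_invK x y : mul x (mul (inv x) y) = y.
Proof.
  destruct Hgroup as [A [I V]]. rewrite <- A, (proj2 (V x)). apply I.
Qed.

Lemma inv_e : inv e = e.
Proof.
  destruct Hgroup as [A [I V]]. rewrite <- (proj2 (V e)) at 2. symmetry. apply I.
Qed.

(** [U] need not be open, so an open [W] inside it is translated, as a preimage under multiplication
    by [inv a]. *)
Lemma translates_open_refinement U : nbd_of_e G opens e U ->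
  exists u : G -> gset, (forall a, opens (u a)) /\ (forall x, u x x) /\
    forall a y, u a y -> exists v, U v /\ y = mul a v.
Proof.
  intros [W [oW [We WU]]]. exists (fun a y => W (mul (inv a) y)).
  split; [|split].
  - intros a. apply Hopens. intros y Wy.
    destruct (Hmul (inv a) y W oW Wy) as [U1 [V1 [_ [oV [Ua [Vy H]]]]]].
    destruct (open_ball_in V1 y oV Vy) as [r [Hr Kr]]. exists r. auto.
  - intros x. destruct Hgroup as [_ [_ V]]. rewrite (proj1 (V x)). exact We.
  - intros a y Wy. exists (mul (inv a) y). rewrite mul_invK. auto.
Qed.

Lemma zero_dim_legal_response (A : gset) (O : gfamily G) :
  zero_dim A -> in_O_nbd G opens mul e O ->
  exists T, legal_response G opens O T /\ forall x, A x -> exists E, T E /\ E x.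
Proof.
  intros ZA [U [HU ->]].
  destruct (translates_open_refinement U HU) as [u [ou [cu iu]]].
  destruct (zero_dim_disjoint_refinement A u ZA ou (fun x => ex_intro _ x (cu x)))
    as [T [oT [dT [iT cT]]]].
  exists T. split; [|exact cT]. split; [exact oT|]. split.
  - intros E E' TE TE' ne x [Ex Ex']. exact (ne (dT E E' x TE TE' Ex Ex')).
  - intros E TE. destruct (iT E TE) as [a Ha].
    exists (fun y => exists v, U v /\ y = mul a v). split; [exists a; reflexivity|]. auto.
Qed.

(** TWO looks only at the last move and the inning number [length past]. *)
Definition summand_strategy (Z : nat -> gset) : strategy G := fun moves =>
  match rev moves with
  | nil => fun _ => False
  | C :: past => epsilon (inhabits (fun _ => False))
      (fun T => legal_response G opens C T /\
                forall x, Z (length past) x -> exists E, T E /\ E x)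
  end.

Lemma summand_strategy_response (Z : nat -> gset) (P : nat -> gfamily G) (k : nat) :
  zero_dim (Z k) -> in_O_nbd G opens mul e (P k) ->
  legal_response G opens (P k) (response G (summand_strategy Z) P k) /\
  forall x, Z k x -> exists E, response G (summand_strategy Z) P k E /\ E x.
Proof.
  intros HZ HP. unfold response, summand_strategy.
  rewrite seq_S, map_app, rev_app_distr. simpl.
  rewrite length_rev, length_map, length_seq.
  apply epsilon_spec, zero_dim_legal_response; assumption.
Qed.

Definition ball_translates (k : nat) : gfamily G :=
  translates G mul (fun y => d e y < / INR (S k)).

Lemma ball_translates_in_O_nbd k : in_O_nbd G opens mul e (ball_translates k).
Proof.
  exists (fun y => d e y < / INR (S k)). split; [|reflexivity].
  exists (fun y => d e y < / INR (S k)). split; [apply open_ball|].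
  rewrite dist_refl. split; [apply inv_INR_S_pos|auto].
Qed.

(** The metric need not be left invariant, so continuity is used: if [x = a v] and [y = a w], then
    [y] is [x] times the inverse of [v] times [w], with [v] and [w] near [e]. *)
Lemma ball_translates_small x (W : gset) : opens W -> W x ->
  exists k, forall E, ball_translates k E -> E x -> forall y, E y -> W y.
Proof.
  intros oW Wx. destruct Hgroup as [A [I V]].
  destruct (Hmul x e W oW) as [V1 [V2 [o1 [o2 [V1x [V2e H12]]]]]].
  { rewrite (proj2 (I x)). exact Wx. }
  destruct (Hmul x e V1 o1) as [V3 [V4 [o3 [o4 [V3x [V4e H34]]]]]].
  { rewrite (proj2 (I x)). exact V1x. }
  destruct (Hinv e V4 o4) as [V5 [o5 [V5e H5]]]; [rewrite inv_e; exact V4e|].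
  destruct (open_ball_in _ e (open_inter V5 V2 o5 o2) (conj V5e V2e)) as [r [Hr Kr]].
  destruct (archimedean_inv r Hr) as [k Hk]. exists k.
  intros E [a ->] [v [Hv Ex]] y [w [Hw ->]].
  apply H12.
  - replace a with (mul x (inv v)).
    + apply H34; [exact V3x|]. apply H5, Kr. lra.
    + rewrite Ex, A, (proj2 (V v)). apply I.
  - apply Kr. lra.
Qed.

(** The answers are disjoint families, and by [ball_translates_small] their members get small around
    each point, as [zero_dim_of_families] requires. *)
Lemma zero_dim_caught (A : gset) (T : nat -> gfamily G) :
  (forall k, legal_response G opens (ball_translates k) (T k)) ->
  zero_dim (fun x => A x /\ forall k, exists E, T k E /\ E x).
Proof.
  intros HT. apply zero_dim_of_families with (T := T).
  - intros k. apply HT.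
  - intros k E E' x TE TE' Ex Ex'. apply NNPP. intros ne.
    exact (proj1 (proj2 (HT k)) E E' TE TE' ne x (conj Ex Ex')).
  - intros k x [_ H]. apply H.
  - intros x W _ oW Wx. destruct (ball_translates_small x W oW Wx) as [k Hk].
    exists k. intros E TE Ex y _ Ey.
    destruct (proj2 (proj2 (HT k)) E TE) as [F [BF EF]].
    exact (Hk F BF (EF x Ex) y (EF y Ey)).
Qed.

(* [resp rho] is TWO's answer to the moves [ball_translates k], [k] in [rho]. *)
Lemma finite_game_zero_dim_decomposition (m : nat) :
  forall (resp : list nat -> gfamily G) (A : gset),
  (forall rho k, (length rho < m)%nat ->
     legal_response G opens (ball_translates k) (resp (rho ++ k :: nil))) ->
  (forall rho x, length rho = m -> A x ->
     exists j E, (j < m)%nat /\ resp (firstn (S j) rho) E /\ E x) ->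
  exists Z : nat -> gset, (forall i, (i < m)%nat -> zero_dim (Z i)) /\
    forall x, A x -> exists i, (i < m)%nat /\ Z i x.
Proof.
  induction m as [|m IH]; intros resp A Hleg Hcov.
  - exists (fun _ => A). split; [intros; lia|]. intros x Ax.
    destruct (Hcov nil x eq_refl Ax) as [j [E [Hj _]]]. lia.
  - set (O := fun k x => exists E, resp (k :: nil) E /\ True /\ E x).
    assert (leg1 : forall k, legal_response G opens (ball_translates k) (resp (k :: nil))).
    { intros k. apply (Hleg nil k). simpl; lia. }
    assert (oO : forall k, opens (O k)) by (intros k; apply open_union_of, leg1).
    (* After a first move [k], the points outside [O k] must be covered in the remaining [m]
       innings. *)
    assert (HZ : forall k, exists Z : nat -> gset, (forall i, (i < m)%nat -> zero_dim (Z i)) /\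
      forall x, A x /\ ~ O k x -> exists i, (i < m)%nat /\ Z i x).
    { intros k. apply (IH (fun rho => resp (k :: rho))).
      - intros rho k' Hrho. apply (Hleg (k :: rho) k'). simpl; lia.
      - intros rho x Hrho [Ax nO].
        destruct (Hcov (k :: rho) x) as [[|j] [E [Hj [RE Ex]]]]; [simpl; lia|exact Ax| |].
        + exfalso. apply nO. exists E. simpl in RE. auto.
        + exists j, E. split; [lia|]. auto. }
    destruct (choice _ HZ) as [Z KZ]. clear HZ.
    set (D := fun k x => forall l, (l < k)%nat -> O l x).
    assert (oD : forall k, opens (D k)) by (intros; apply open_inter_lt; auto).
    (* [k] is the first move whose answer misses [x]; the decomposition chosen for that move
       applies. *)
    set (Z' := fun i x => exists k, ~ O k x /\ D k x /\ Z k i x).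
    exists (fun i => if Nat.eq_dec i m
              then fun x => A x /\ forall k, exists E, resp (k :: nil) E /\ E x else Z' i).
    split.
    + intros i Hi. destruct (Nat.eq_dec i m) as [h|h]; [apply zero_dim_caught, leg1|].
      set (key := fun c => fst (Cantor.of_nat c)).
      set (rad := fun c => / INR (S (snd (Cantor.of_nat c)))).
      (* The condition defining [D k] is open, so it is exhausted by the closed sets where its gauge
         is at least some [1/(p+1)]; [c] codes [(k, p)]. *)
      set (H := fun c x => O (key c) x \/ gauge (D (key c)) x < rad c).
      assert (oH : forall c, opens (H c)) by (intros; apply open_cup; [auto|apply open_gauge_lt]).
      assert (HD : forall c x, ~ H c x -> D (key c) x).
      { intros c x nH. apply gauge_pos_in. apply Rlt_le_trans with (rad c); [apply inv_INR_S_pos|].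
        apply Rnot_lt_le. intros k. apply nH. right. exact k. }
      apply zero_dim_countable_closed_union with (B := fun c x => Z' i x /\ ~ H c x) (H := H).
      * exact oH.
      * tauto.
      * intros x [k [nO [Dx Zx]]].
        destruct (archimedean_inv _ (gauge_pos (D k) x (oD k) Dx)) as [p Hp].
        exists (Cantor.to_nat (k, p)). split; [exists k; auto|].
        unfold H, key, rad. rewrite Cantor.cancel_of_to. cbn [fst snd].
        intros [h'|h']; [auto|lra].
      * intros c. apply zero_dim_closed_subset with (A := Z (key c) i) (H := H c).
        -- apply KZ. lia.
        -- apply oH.
        (* Off [H c] the first missing move is [key c], so the [k] in [Z' i] is forced. *)
        -- intros x. split; intros [H1 nH]; (split; [|exact nH]).
           ++ destruct H1 as [k [nO [Dx Zx]]].
              assert (nO' : ~ O (key c) x) by (intros h'; apply nH; left; exact h').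
              replace (key c) with k; [exact Zx|].
              destruct (Nat.lt_trichotomy k (key c)) as [h'|[h'|h']]; [|exact h'|].
              ** destruct (nO (HD c x nH k h')).
              ** destruct (nO' (Dx _ h')).
           ++ exists (key c). split; [intros h'; apply nH; left; exact h'|].
              split; [apply HD, nH|exact H1].
    + intros x Ax. destruct (classic (forall k, O k x)) as [h|h].
      * exists m. split; [lia|]. destruct (Nat.eq_dec m m) as [_|]; [|contradiction].
        split; [exact Ax|]. intros k. destruct (h k) as [E [RE [_ Ex]]]. eauto.
      * apply not_all_ex_not in h. destruct (least_nat _ h) as [k [nO Hl]].
        destruct (proj2 (KZ k) x (conj Ax nO)) as [i [Hi Zx]].
        exists i. split; [lia|]. destruct (Nat.eq_dec i m) as [|_]; [lia|].
        exists k. split; [exact nO|]. split; [|exact Zx].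
        intros l Hlk. apply NNPP. exact (Hl l Hlk).
Qed.

(** * Plays of translated balls and the four implications *)

Lemma map_nth_seq_firstn (l : list nat) : forall k, (k <= length l)%nat ->
  map (fun i => nth i l 0%nat) (seq 0 k) = firstn k l.
Proof.
  induction l as [|a l IH]; intros [|k] Hk; simpl in *; try lia; [reflexivity|reflexivity|].
  f_equal. rewrite <- seq_shift, map_map. apply IH. lia.
Qed.

Lemma response_ball_translates (s : strategy G) (f : nat -> nat) (k : nat) :
  response G s (fun i => ball_translates (f i)) k =
  s (map ball_translates (map f (seq 0 (S k)))).
Proof. unfold response. rewrite map_map. reflexivity. Qed.

(** A finite history becomes an infinite play through the default 0 of [nth]; innings within the
    history do not see the default. *)
Lemma response_ball_translates_nth (s : strategy G) (l : list nat) (k : nat) :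
  (k < length l)%nat ->
  response G s (fun i => ball_translates (nth i l 0%nat)) k =
  s (map ball_translates (firstn (S k) l)).
Proof.
  intros Hk. rewrite response_ball_translates, map_nth_seq_firstn by lia. reflexivity.
Qed.

Lemma response_ball_translates_last (s : strategy G) (rho : list nat) (k : nat) :
  response G s (fun i => ball_translates (nth i (rho ++ k :: nil) 0%nat)) (length rho) =
  s (map ball_translates (rho ++ k :: nil)).
Proof.
  rewrite response_ball_translates_nth by (rewrite length_app; simpl; lia).
  rewrite firstn_all2 by (rewrite length_app; simpl; lia). reflexivity.
Qed.

Lemma dim_le_winning_finite (n : nat) :
  dim_le G opens whole n -> exists s, winning_finite G opens mul e (S n) s.
Proof.
  intros Hdim. destruct (dim_le_zero_dim_decomposition n Hdim) as [Z [HZ cZ]].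
  exists (summand_strategy Z). intros P HP. split.
  - intros k Hk. apply summand_strategy_response; auto.
  - intros x. destruct (cZ x) as [j [Hj Zx]].
    destruct (summand_strategy_response Z P j) as [_ H]; [auto|apply HP; lia|].
    destruct (H x Zx) as [E [RE Ex]]. exists j, E. split; [lia|]. auto.
Qed.

Lemma winning_finite_dim_le (n : nat) (s : strategy G) :
  winning_finite G opens mul e (S n) s -> dim_le G opens whole n.
Proof.
  intros Hs.
  destruct (finite_game_zero_dim_decomposition (S n)
              (fun tau => s (map ball_translates tau)) whole) as [Z [HZ cZ]].
  - intros rho k Hrho.
    destruct (Hs (fun i => ball_translates (nth i (rho ++ k :: nil) 0%nat))) as [H _].
    { intros; apply ball_translates_in_O_nbd. }
    specialize (H (length rho) Hrho).
    rewrite response_ball_translates_last, nth_middle in H. exact H.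
  - intros rho x Hrho _.
    destruct (Hs (fun i => ball_translates (nth i rho 0%nat))) as [_ H].
    { intros; apply ball_translates_in_O_nbd. }
    destruct (H x) as [k [E [Hk [RE Ex]]]]. exists k, E. split; [exact Hk|].
    rewrite response_ball_translates_nth in RE by lia. auto.
  - apply dim_le_of_zero_dim_union with (Z := Z); [| |trivial].
    + intros i Hi. apply HZ. lia.
    + intros x _. destruct (cZ x I) as [i [Hi Zx]]. exists i. split; [lia|exact Zx].
Qed.

Lemma countable_dimensional_winning_omega :
  countable_dimensional G opens -> exists s, winning_omega G opens mul e s.
Proof.
  intros [Z [cZ HZ]]. exists (summand_strategy Z). intros P HP. split.
  - intros k. apply summand_strategy_response; [apply dim_le_zero_dim, HZ|apply HP].
  - intros x. destruct (cZ x) as [k Zx].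
    destruct (summand_strategy_response Z P k) as [_ H]; [apply dim_le_zero_dim, HZ|apply HP|].
    exists k. exact (H x Zx).
Qed.

(** If [x] were caught for all next moves at no history, ONE could always pick a move whose answer
    misses [x], and that play would leave [x] uncovered. *)
Lemma winning_omega_countable_dimensional (s : strategy G) :
  winning_omega G opens mul e s -> countable_dimensional G opens.
Proof.
  intros Hs.
  set (resp := fun tau => s (map ball_translates tau)).
  set (tau := fun c => decode_list (fst (Cantor.of_nat c)) (snd (Cantor.of_nat c))).
  exists (fun c x => True /\ forall k, exists E, resp (tau c ++ k :: nil) E /\ E x). split.
  - intros x. apply NNPP. intros Hno.
    assert (Hnext : forall l, exists k, ~ exists E, resp (l ++ k :: nil) E /\ E x).
    { intros l. apply not_all_ex_not. intros Hl. apply Hno.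
      destruct (decode_list_surj l) as [c Hc]. exists (Cantor.to_nat (length l, c)).
      unfold tau. rewrite Cantor.cancel_of_to. cbn [fst snd]. rewrite Hc. auto. }
    destruct (choice _ Hnext) as [next Kn].
    (* [pre n] is the history of the first [n] moves of the play that avoids [x]. *)
    set (pre := fix pre n := match n with O => nil | S n => pre n ++ next (pre n) :: nil end).
    assert (Epre : forall n, map (fun i => next (pre i)) (seq 0 n) = pre n).
    { induction n as [|n IH]; [reflexivity|]. rewrite seq_S, map_app, IH. reflexivity. }
    destruct (Hs (fun i => ball_translates (next (pre i)))) as [_ H].
    { intros; apply ball_translates_in_O_nbd. }
    destruct (H x) as [k [E [RE Ex]]].
    rewrite response_ball_translates, Epre in RE.
    apply (Kn (pre k)). exists E. auto.
  - intros c. apply zero_dim_dim_le, (zero_dim_caught whole).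
    intros k. destruct (Hs (fun i => ball_translates (nth i (tau c ++ k :: nil) 0%nat))) as [H _].
    { intros; apply ball_translates_in_O_nbd. }
    specialize (H (length (tau c))).
    rewrite response_ball_translates_last, nth_middle in H. exact H.
Qed.

End Metric.

Theorem theorem4p1 (G : Type) (opens : gfamily G) (mul : G -> G -> G)
    (inv : G -> G) (e : G) :
  metrizable_topological_group G opens mul inv e ->
  (forall n : nat,
     (dim_le G opens (fun _ => True) n ->
        exists s : strategy G, winning_finite G opens mul e (S n) s) /\
     ((exists s : strategy G, winning_finite G opens mul e (S n) s) ->
        dim_le G opens (fun _ => True) n)) /\
  (countable_dimensional G opens ->
     exists s : strategy G, winning_omega G opens mul e s) /\
  ((exists s : strategy G, winning_omega G opens mul e s) ->
     countable_dimensional G opens).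
Proof.
  intros [Hgroup [Hmul [Hinv [d [Hd Hopens]]]]].
  split; [|split].
  - intros n. split.
    + eapply dim_le_winning_finite; eassumption.
    + intros [s Hs]. eapply winning_finite_dim_le; eassumption.
  - eapply countable_dimensional_winning_omega; eassumption.
  - intros [s Hs]. eapply winning_omega_countable_dimensional; eassumption.
Qed.
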